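(* Let $\mu>0$ and let $\Phi_t$ be the solution of the initial value problem $$\frac{\partial\Phi_t}{\partial t}(\phi)=\mu\Delta\Phi_t(\phi)-\sum_{X=1}^da_X\frac{\partial}{\partial\phi_X}\Phi_t(\phi)+z\int_{\mathbb{R}^d\setminus\{0\}}[\Phi_t(\phi+\varphi)-\Phi_t(\phi)]\,dr(\varphi),\qquad\Phi_0=\delta_0 .$$ Suppose that the support of the jump distribution $r$ is compact. Let $t>0$, $\phi\in\mathbb{R}^d$ and $\beta=1/(4\mu t)$. Let $B(\tau,t,\phi)$ be the analytic continuation in $\tau$ of $$\sum_{m=0}^\infty\frac{(-\tau)^m}{(m!)^2}\sum_{G\in\bar Q(m)}\mathcal{V}[G](t,\phi)$$ (which converges for small $|\tau|$) to some strip of the form $S_\sigma=\{\tau\in\mathbb{C}:\mathrm{dist}(\tau,\mathbb{R}_+)<1/\sigma\}$, $\sigma>0$ (such a continuation exists for some $\sigma$). Then $$\Phi_t(\phi)=\pi^{-d/2}\beta^{d/2-1}\int_0^\infty e^{-\tau/\beta}B(\tau,t,\phi)\,d\tau .$$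
   Context: Data: $a\in\mathbb{R}^d$, $z\ge0$, $r$ a probability measure on $\mathbb{R}^d\setminus\{0\}$; $\delta_0$ is the Dirac measure at $0$, $\Delta$ the Laplacian. Solution: with $\mathcal{F}(g)(\xi)=\int g(\varphi)e^{i\langle\xi,\varphi\rangle}d\varphi$, let $\Psi^{\rm jump}(\eta)=-\langle a,\eta\rangle+z\int(e^{\langle\eta,\varphi\rangle}-1)\,dr(\varphi)$ be the symbol of the non-diffusive part, $\nu_t=\mathcal{F}^{-1}(e^{t\Psi^{\rm jump}(-i\xi)})$, and $\Phi_t^{\rm diff.}(\phi)=(4\pi\mu t)^{-d/2}e^{-\|\phi\|^2/(4\mu t)}=(\beta/\pi)^{d/2}e^{-\beta\|\phi\|^2}$; the solution is the convolution $\Phi_t=\nu_t*\Phi_t^{\rm diff.}$. Coefficients: $C^{(n)}_{X_1\cdots X_n}=\frac{\partial^n}{\partial\eta_{X_1}\cdots\partial\eta_{X_n}}\Psi^{\rm jump}(\eta)|_{\eta=0}$, i.e. $C^{(1)}_X=-a_X+z\int\varphi_X\,dr(\varphi)$ and $C^{(n)}_{X_1\cdots X_n}=z\int\varphi_{X_1}\cdots\varphi_{X_n}\,dr(\varphi)$ for $n\ge2$. Graphs: $\bar Q(m)$ is the set of graphs with $m$ distinguishable (numbered $1,\dots,m$) directed edges and with two types of vertices, ''inner empty'' and ''outer empty'', indistinguishable within each type; multiple edges and edges joining a vertex to itself are allowed; every vertex is met by at least one edge-end and every outer empty vertex by exactly one edge-end. (Equivalently: surjective maps from the set $\{1,\dots,m\}\times\{1,2\}$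 of edge-ends to a finite set of vertices each marked inner or outer, injective over outer ones, up to type-preserving relabelling of vertices.) $\bar Q(0)$ consists of the empty graph, of value $1$. Value: for $G\in\bar Q(m)$, $\mathcal{V}[G](t,\phi)$ is obtained by assigning to each edge $j$ an index $X_j\in\{1,\dots,d\}$, multiplying by $t\,C^{(l)}_{X_{j_1}\cdots X_{j_l}}$ for each inner empty vertex met by edge-ends belonging to the edges $j_1,\dots,j_l$ (an edge joining the vertex to itself is listed twice), multiplying by $\phi_{X_j}$ for each outer empty vertex met by edge $j$, and summing over $X_1,\dots,X_m\in\{1,\dots,d\}$. *)

(* Defs.v *)
From HB Require Import structures.
From mathcomp Require Import all_boot all_order all_algebra.
From mathcomp Require Import all_classical all_reals all_analysis.
From mathcomp Require Export complex.

Set Implicit Arguments.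
Unset Strict Implicit.
Unset Printing Implicit Defensive.

Import Order.TTheory GRing.Theory Num.Theory.
Import numFieldNormedType.Exports.

Local Open Scope classical_set_scope.
Local Open Scope ring_scope.
Local Open Scope complex_scope.

(* The usual topology of the complex plane, given by the modulus. *)
HB.instance Definition _ (R : realType) := NormedModule.copy R[i] R[i]^o.

(* R^d with its Borel sigma-algebra; an alias of 'rV[R]_d, which carries the
   topology and the vector space structure. *)
Definition borel_rV (R : realType) (d : nat) :=
  g_sigma_algebraType (@open 'rV[R]_d).

(* Bilinear also when K is complex: no conjugation. *)
Definition dot (K : pzRingType) (d : nat) (u v : 'rV[K]_d) : K :=
  \sum_(i < d) u 0 i * v 0 i.

Section complex_integration.
Context {R : realType}.

Definition cexp (w : R[i]) : R[i] :=
  (expR (complex.Re w))%:C * (cos (complex.Im w) +i* sin (complex.Im w)).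

Context {disp : measure_display} {T : measurableType disp}.
Variable m : {measure set T -> \bar R}.

Definition Cintegrable (D : set T) (f : T -> R[i]) : Prop :=
  m.-integrable D (EFin \o (fun x => complex.Re (f x))) /\
  m.-integrable D (EFin \o (fun x => complex.Im (f x))).

Definition Cintegral (D : set T) (f : T -> R[i]) : R[i] :=
  (\int[m]_(x in D) complex.Re (f x)) +i* (\int[m]_(x in D) complex.Im (f x)).

End complex_integration.

Section levy.
Context {R : realType} {d : nat}.
Implicit Types (a phi eta xi : 'rV[R]_d) (r nu : probability (borel_rV R d) R).

Definition msupport r : set 'rV[R]_d :=
  [set x | forall U : set 'rV[R]_d, open U -> U x -> (0 < r U)%E].

Definition psi_jump a (z : R) r eta : R :=
  - dot a eta + z * \int[r]_x (expR (dot eta x) - 1).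

(* The same symbol at complex arguments. *)
Definition psi_jumpC a (z : R) r (eta : 'rV[R[i]]_d) : R[i] :=
  - dot (map_mx (real_complex R) a) eta +
  z%:C * Cintegral r setT
           (fun x => cexp (dot eta (map_mx (real_complex R) x)) - 1).

Definition fourier nu xi : R[i] :=
  Cintegral nu setT (fun x => cexp ('i * (dot xi x)%:C)).

Definition gauss (mu t : R) phi : R :=
  (4 * pi * mu * t) `^ (- (d%:R / 2)) * expR (- (dot phi phi / (4 * mu * t))).

Definition conv nu (g : 'rV[R]_d -> R) phi : R :=
  \int[nu]_x g (phi - (x : 'rV[R]_d)).

(* Phi t = nu_t * gauss mu t, where nu_t is the inverse Fourier transform of
   xi |-> e^(t psi(- i xi)), i.e. the measure whose Fourier transform is that
   function. *)
Definition levy_solution (mu : R) a (z : R) r (Phi : R -> 'rV[R]_d -> R) :=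
  forall t, 0 < t ->
    exists nu : probability (borel_rV R d) R,
      (forall xi, fourier nu xi =
         cexp (t%:C * psi_jumpC a z r (- 'i *: map_mx (real_complex R) xi))) /\
      (forall phi, Phi t phi = conv nu (gauss mu t) phi).

(* d^n psi_jump / d eta_X1 .. d eta_Xn at eta = 0, for Xs = [:: X1; ..; Xn]. *)
Definition jump_coef a (z : R) r (Xs : seq 'I_d) : R :=
  foldr (fun X (f : 'rV[R]_d -> R) => 'D_(delta_mx 0 X) f)
        (psi_jump a z r) Xs 0.

End levy.

(* The two ends (j, false), (j, true) of the directed edge j. *)
Definition edge_end (m : nat) : finType := ('I_m * bool)%type.

(* As vertices are indistinguishable within their type and each is met by some
   edge-end, a vertex is identified with the set of edge-ends meeting it: a
   graph up to relabelling of its vertices is a partition of the edge-ends into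
   inner and outer blocks. *)
Record graph (m : nat) := Graph {
  inner : {set {set edge_end m}};
  outer : {set {set edge_end m}} }.

Definition graph_pair m (G : graph m) := (inner G, outer G).
Definition pair_graph m (p : {set {set edge_end m}} * {set {set edge_end m}}) :=
  Graph p.1 p.2.
Lemma graph_pairK m : cancel (@graph_pair m) (@pair_graph m).
Proof. by case. Qed.
HB.instance Definition _ m := Finite.copy (graph m) (can_type (@graph_pairK m)).

Definition Qbar (m : nat) : {set graph m} :=
  [set G | [&& finset.partition (inner G :|: outer G) [set: edge_end m],
               [disjoint inner G & outer G] &
               [forall v in outer G, #|v| == 1%N]]]%SET.

Section borel_transform.
Context {R : realType} {d : nat}.
Variables (a : 'rV[R]_d) (z : R) (r : probability (borel_rV R d) R).
Variables (t : R) (phi : 'rV[R]_d).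

Definition graph_value (m : nat) (G : graph m) : R :=
  \sum_(X : {ffun 'I_m -> 'I_d})
    (\prod_(v in inner G) (t * jump_coef a z r [seq X e.1 | e <- enum v])) *
    (\prod_(v in outer G) \prod_(e in v) phi 0 (X e.1)).

Definition borel_term (tau : R[i]) (m : nat) : R[i] :=
  (- tau) ^+ m / (m`!%:R ^+ 2) * (\sum_(G in Qbar m) graph_value G)%:C.

End borel_transform.

Section analytic.
Context {R : realType}.

Definition strip (sigma : R) : set R[i] :=
  [set tau | inf [set Normc.normc (tau - s%:C) | s in [set s : R | 0 <= s]]
             < 1 / sigma].

Definition analytic_on (A : set R[i]) (B : R[i] -> R[i]) : Prop :=
  forall c, A c -> exists u : nat -> R[i],
    \forall w \near c, series (fun n => u n * (w - c) ^+ n) @ \oo --> B w.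

Definition analytic_continuation (s : R[i] -> nat -> R[i]) (A : set R[i])
    (B : R[i] -> R[i]) : Prop :=
  analytic_on A B /\ \forall tau \near 0, series (s tau) @ \oo --> B tau.

End analytic.

(* Main.v *)
Require Import Defs.
From HB Require Import structures.
From mathcomp Require Import all_boot all_order all_algebra.

Set Implicit Arguments.
Unset Strict Implicit.
Unset Printing Implicit Defensive.

Import Order.TTheory GRing.Theory Num.Theory.

Local Open Scope ring_scope.

(** Let [lam = t z] and let [P] be the law of [- t a + Y_1 + .. + Y_n], where the
    [Y_i] are independent with law [r] and [n] is an independent Poisson number
    of mean [lam].  As [r] has compact support, [P] has finite exponential
    moments; its moment generating function is [exp(t psi_jump)]
    ([compound_poisson_mgf]), and its characteristic function is the complex
    conjugate of that of the law [nu] in the definition of the solution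
    ([fourier_levy]).  Thus [nu] is the reflection of [P], and with
    [rho x = |phi + x|^2] the solution is
    [Phi t phi = (beta / pi)^(d/2) * int exp(- beta * rho) dP].
    Only the mean of a Gaussian function has to be transferred from [nu] to [P]:
    such a function is a bounded limit of products of cosines, whose means are
    determined by the characteristic function ([gaussian_mean]).

    The graphs come from the moments of [rho].  Expanding the scalar products in
    [int rho^m dP] assigns an index to each of the [m] edges and lets each
    edge-end choose between [phi] and [x]; the ends that choose [phi] are the
    outer vertices.  The remaining mixed moment of [P] is the sum over the set
    partitions of the other ends of the products of the cumulants of [P], because
    the derivatives of [M = exp(t psi_jump)] obey [d_e M = t (d_e psi_jump) M]
    ([moment_partition]).  These cumulants are [t] times the coefficients
    [jump_coef], so that the sum of the values of the graphs in [Qbar m] is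
    [int rho^m dP] ([moment_graphs]).

    The Borel series is therefore
    [sum_m (- tau)^m / (m!)^2 * int rho^m dP = int J(rho * tau) dP], where
    [J u = sum_m (- u)^m / (m!)^2] is the Bessel function [J_0(2 sqrt u)].  It
    converges for all complex [tau], its sum is an analytic continuation to every
    strip ([complex_borel]), and by the identity theorem every analytic
    continuation agrees with it on the half-line ([analytic_half_line]).
    Finally [J] is bounded by 1 on the half-line ([normr_bessel_le1]) and
    [int_0^oo exp(- tau / beta) J(rho * tau) dtau = beta * exp(- beta * rho)]
    ([laplace_bessel]); exchanging the integrals ([laplace_borel_real]) gives the
    formula. *)

(** * Sums over set partitions and over graphs *)

Section set_partitions.
Context {K : comNzRingType} {E : finType}.
Implicit Types (U v S : {set E}) (p : {set {set E}}) (e : E).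

Lemma sum_subsetU1 e U (F : {set E} -> K) : e \notin U ->
  \sum_(v : {set E} | v \subset e |: U) F v =
  \sum_(v : {set E} | v \subset U) F v +
  \sum_(v : {set E} | v \subset U) F (e |: v).
Proof.
move=> eU; rewrite (bigID (fun v : {set E} => e \in v))/= addrC; congr (_ + _).
  apply: eq_bigl => v; apply/andP/idP => [[vU ev]|vU].
    apply/subsetP => x xv; have := subsetP vU _ xv; rewrite !inE.
    by case/predU1P => // xe; rewrite xe (negPf ev) in xv.
  split; first exact: subset_trans vU (subsetUr _ _).
  by apply: contra eU => /(subsetP vU).
rewrite (reindex_onto (fun v => e |: v) (fun v => v :\ e)); last first.
  by move=> v /andP[_ ev]; rewrite setD1K.
apply: eq_bigl => v; rewrite setU11 andbT; apply/andP/idP => [[vU /eqP vE]|vU].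
  rewrite -vE; apply/subsetP => x; rewrite !inE => /andP[xe].
  rewrite (negPf xe)/= => xv; have := subsetP vU x.
  by rewrite !inE xv orbT (negPf xe) => /(_ isT).
split; first exact: setUS.
by rewrite setU1K//; apply: contra eU => /(subsetP vU).
Qed.

(** The sum over the partitions of [U] of the products of the weights of their
    blocks: the formula giving moments in terms of cumulants. *)
Definition partition_sum (kappa : {set E} -> K) U : K :=
  \sum_(p : {set {set E}} | finset.partition p U) \prod_(v in p) kappa v.

Lemma partition_sum0 kappa : partition_sum kappa set0 = 1.
Proof.
rewrite /partition_sum (big_pred1 set0) ?big_set0// => p.
exact: partition_set0.
Qed.

(** Singling out the block that contains a given element. *)
Lemma partition_sumU1 kappa e U : e \notin U ->
  partition_sum kappa (e |: U) =
  \sum_(v : {set E} | v \subset U) kappa (e |: v) * partition_sum kappa (U :\: v).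
Proof.
move=> eU; rewrite /partition_sum.
rewrite (partition_big (fun p => pblock p e :\ e) (fun v => v \subset U))/=; last first.
  move=> p /[dup] pU /and3P[/eqP cU tU _]; apply/subsetP => x; rewrite !inE => /andP[xe xp].
  have : x \in cover p.
    apply/bigcupP; exists (pblock p e) => //; apply: pblock_mem.
    by rewrite cU setU11.
  by rewrite cU !inE (negPf xe).
apply: eq_bigr => v vU.
have ev : e \notin v by apply: contra eU => /(subsetP vU).
have disj : [disjoint e |: v & U :\: v].
  rewrite -setI_eq0; apply/eqP/setP => x; rewrite !inE.
  apply/negP => /andP[/orP[/eqP->|xv]] /andP[]; first by rewrite (negPf eU).
  by rewrite xv.
have UE : e |: U = (e |: v) :|: (U :\: v).
  apply/setP => x; rewrite !inE; case: (eqVneq x e) => //= _.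
  by case: (boolP (x \in v)) => //= /(subsetP vU) ->.
rewrite big_distrr/= (reindex_onto (fun p => (e |: v) |: p) (fun p => p :\ (e |: v))); last first.
  move=> p /andP[/and3P[/eqP cU tU _] /eqP vE].
  rewrite setD1K// -vE setD1K ?pblock_mem ?cU ?setU11//.
  by rewrite mem_pblock cU setU11.
have nB (p : {set {set E}}) : finset.partition p (U :\: v) -> e |: v \notin p.
  move=> pp; apply/negP => vp; have := partitionS pp vp.
  by move=> /subsetP /(_ e); rewrite !inE eqxx (negPf eU) andbF => /(_ isT).
apply/esym/eq_big => [p|p /nB pp]; last by rewrite big_setU1.
apply/esym; apply/andP/idP => [[/andP[pp _] /eqP pE]|pp].
  have := partitionD1 pp (setU11 _ _); rewrite pE UE.
  rewrite setDUl setDv set0U.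
  by move: disj; rewrite disjoint_sym => /setDidPl ->.
have v0 : e |: v != set0 by apply/set0Pn; exists e; rewrite setU11.
have pU : finset.partition (e |: v |: p) (e |: U) by rewrite UE partitionU1.
have [_ tU _] := and3P pU.
split; last by rewrite setU1K// nB.
by rewrite pU/= (def_pblock tU (setU11 _ _) (setU11 _ _)) setU1K.
Qed.

(** A set function that obeys the recursion of [partition_sumU1] is given by
    the sum over partitions. *)
Lemma partition_sum_unique kappa (M : {set E} -> K) : M set0 = 1 ->
  (forall e U, e \notin U ->
    M (e |: U) = \sum_(v : {set E} | v \subset U) kappa (e |: v) * M (U :\: v)) ->
  forall U, M U = partition_sum kappa U.
Proof.
move=> M0 MU U; have [n] := ubnP #|U|; elim: n U => // n ih U Un.
have [->|[e eU]] := set_0Vmem U; first by rewrite M0 partition_sum0.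
rewrite -(setD1K eU) MU ?partition_sumU1 ?setD11//; apply: eq_bigr => v vU.
rewrite ih//; apply: leq_ltn_trans (subset_leq_card (subsetDl _ _)) _.
by move: Un; rewrite (cardsD1 e) eU.
Qed.

End set_partitions.

Section graph_sums.
Context {K : comNzRingType} (m : nat).
Local Notation E := (edge_end m).

(** The sets of singletons correspond to the unions [S] of their members; what
    remains of a graph is a partition of the complement of [S]. *)
Lemma sum_Qbar (kappa : {set E} -> K) (f : E -> K) :
  \sum_(G in Qbar m) (\prod_(v in inner G) kappa v) *
      (\prod_(v in outer G) \prod_(e in v) f e) =
  \sum_(S : {set E}) (\prod_(e in S) f e) * partition_sum kappa (~: S).
Proof.
rewrite (partition_big (fun G => cover (outer G)) xpredT)//=; apply: eq_bigr => S _.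
pose O : {set {set E}} := [set [set e] | e in S].
have coverO : cover O = S.
  by rewrite /O cover_imset; apply/setP => x; apply/bigcupP/idP => [[y yS /set1P->]//|xS];
    exists x => //; rewrite set11.
have set1_inj : {in S &, injective (fun e : E => [set e])} by move=> x y _ _ /set1_inj.
rewrite (reindex_onto (fun p => Graph p O) (@inner m)); last first.
  move=> [i o] /=; rewrite inE /= => /andP[/and3P[_ _ /forall_inP o1] /eqP oS].
  congr Graph; apply/setP => v; apply/imsetP/idP => [[x xS ->]|vo].
    move: xS; rewrite -oS => /bigcupP[w wo xw].
    by have /cards1P[y wy] := o1 _ wo; move: xw; rewrite wy => /set1P ->; rewrite -wy.
  have /cards1P[y vy] := o1 _ vo; exists y => //; rewrite -oS.
  by apply/bigcupP; exists v; rewrite // vy set11.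
rewrite /partition_sum big_distrr/=; apply: eq_big => [p|p _].
  rewrite !inE /= coverO !eqxx !andbT.
  have O1 : [forall v in O, #|v| == 1%N].
    by apply/forall_inP => v /imsetP[x _ ->]; rewrite cards1.
  rewrite O1 andbT; apply/andP/idP => [[pO dO]|pS].
    have [/eqP cpO tpO p0] := and3P pO.
    have pS0 x B : B \in p -> x \in B -> x \notin S.
      move=> Bp xB; apply/negP => xS.
      have xO : [set x] \in O by apply/imsetP; exists x.
      have e1 := def_pblock tpO (subsetP (subsetUl _ _) _ Bp) xB.
      have e2 := def_pblock tpO (subsetP (subsetUr _ _) _ xO) (set11 x).
      move: Bp; rewrite -e1 e2 => Bp.
      by move/pred0P: dO => /(_ [set x]) /=; rewrite Bp xO.
    apply/and3P; split.
    - apply/eqP/setP => x; rewrite in_setC; apply/bigcupP/idP => [[B Bp xB]|xS].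
        exact: pS0 Bp xB.
      have : x \in cover (p :|: O) by rewrite cpO inE.
      case/bigcupP => B; rewrite inE => /orP[Bp xB|]; first by exists B.
      by case/imsetP => y yS -> /set1P xy; rewrite xy yS in xS.
    - exact: (trivIsetS (subsetUl _ _) tpO).
    - by apply: contra p0; rewrite inE => ->.
  have [/eqP cp tp p0] := and3P pS.
  have BS B x : B \in p -> x \in B -> x \notin S.
    by move=> Bp xB; rewrite -in_setC -cp; apply/bigcupP; exists B.
  split; last first.
    apply/pred0P => B /=; apply/negP => /andP[Bp /imsetP[x xS BE]].
    by have := BS B x Bp; rewrite BE set11 xS => /(_ isT).
  apply/and3P; split.
  - apply/eqP/setP => x; rewrite [RHS]inE; apply/bigcupP.
    have [xS|xS] := boolP (x \in S).
      by exists [set x]; rewrite ?set11// inE; apply/orP; right; apply/imsetP; exists x.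
    have : x \in cover p by rewrite cp in_setC.
    by case/bigcupP => B Bp xB; exists B => //; rewrite inE Bp.
  - apply/trivIsetP => A B; rewrite !inE => /orP[Ap|/imsetP[x xS ->]]
      /orP[Bp|/imsetP[y yS ->]] AB.
    + exact: (trivIsetP tp).
    + by rewrite disjoint_sym disjoints1; apply/negP => /(BS _ _ Ap); rewrite yS.
    + by rewrite disjoints1; apply/negP => /(BS _ _ Bp); rewrite xS.
    + by rewrite disjoints1 inE; apply: contra AB => /eqP ->.
  - rewrite inE negb_or p0/=; apply/imsetP => -[x _ /setP /(_ x)].
    by rewrite !inE eqxx.
rewrite mulrC; congr (_ * _); rewrite big_imset//=.
by apply: eq_bigr => e _; rewrite big_set1.
Qed.

End graph_sums.

(* Classical sets reuse many of the names of the finite sets used above. *)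
From mathcomp Require Import all_classical all_reals all_analysis.
From mathcomp Require Import measurable_realfun.
From mathcomp Require Import ring lra.

Import numFieldNormedType.Exports.

Local Open Scope classical_set_scope.
Local Open Scope ring_scope.

(** * Measurability in R^d and the support of a measure *)

Section borel_rV_theory.
Context {R : realType} {d : nat}.
Local Notation V := 'rV[R]_d.
Local Notation BV := (borel_rV R d).

Lemma open_measurable_rV (U : set V) : open U -> measurable (U : set BV).
Proof. by move=> oU; apply: sub_sigma_algebra. Qed.

Lemma continuous_measurable_rV (f : V -> R) : continuous f ->
  measurable_fun setT (f : BV -> R).
Proof.
move=> cf; apply: (measurability _ (RGenOpens.measurableE R)) => //.
move=> _ [_ [a [b ->]] <-]; rewrite setTI.
apply: open_measurable_rV; apply: open_comp => //.
Qed.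

Lemma measurable_coord (i : 'I_d) :
  measurable_fun setT (fun x : BV => (x : V) 0 i).
Proof. by apply: continuous_measurable_rV; exact: coord_continuous. Qed.

Lemma measurable_norm_rV : measurable_fun setT (fun x : BV => `|x : V|).
Proof. by apply: continuous_measurable_rV; exact: norm_continuous. Qed.

(** An enumeration of the sup-norm balls with rational centres and radii
    [1 / (n + 1)]; the codes that name no ball give the empty set. *)
Definition rat_ball (k : nat) : set V :=
  if @unpickle ('rV[rat]_d * nat)%type k is Some p
  then ball (map_mx ratr p.1 : V) (p.2.+1%:R^-1) else set0.

Lemma rat_ball_open k : open (rat_ball k).
Proof.
by rewrite /rat_ball; case: unpickle => [p|]; [exact: ball_open|exact: open0].
Qed.

Lemma open_rat_ball (U : set V) : open U ->
  U = \bigcup_(k in [set k | rat_ball k `<=` U]) rat_ball k.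
Proof.
move=> oU; apply/seteqP; split=> [x Ux|x [p /= pU px]]; last exact: pU.
have /nbhs_ballP[e /= e0 xeU] : nbhs x U by exact: open_nbhs_nbhs.
have [n ne] : exists n : nat, n.+1%:R^-1 < e / 2.
  have /ltr_add_invr[k] : 0 < e / 2 by rewrite divr_gt0.
  by rewrite add0r; exists k.
have n0 : 0 < n.+1%:R^-1 :> R by rewrite invr_gt0.
have /choice[q xq] : forall i : 'I_d, exists q : rat,
    `|x 0 i - ratr q| < n.+1%:R^-1.
  move=> i; have /rat_in_itvoo[q] :
      x 0 i - n.+1%:R^-1 < x 0 i + n.+1%:R^-1 by rewrite ltrD2l gtrN.
  by rewrite in_itv/= => /andP[q1 q2]; exists q; rewrite ltr_distlC q1 q2.
have xqn : ball (map_mx ratr (\row_i q i) : V) (n.+1%:R^-1) x.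
  split=> // i j; rewrite (ord1 i) !mxE.
  by rewrite /ball/= distrC; exact: xq.
exists (pickle (\row_i q i, n)); rewrite /= /rat_ball pickleK//=.
move=> y yq; apply: xeU.
apply: (@le_ball _ _ _ (n.+1%:R^-1 + n.+1%:R^-1)).
  by rewrite [leRHS]splitr; apply: lerD; exact: ltW.
by apply: ball_triangle yq; exact: ball_sym.
Qed.

(** The product of the Borel sigma-algebras of the coordinates is the Borel
    sigma-algebra of the space, because open sets are countable unions of
    boxes. *)
Lemma measurable_fun_rV {dT} {T : measurableType dT} (f : T -> BV) :
  (forall i, measurable_fun setT (fun x => (f x : V) 0 i)) ->
  measurable_fun setT f.
Proof.
move=> mf; apply: (@measurability _ _ _ BV _ _ (@open V)) => // _ [U oU <-].
rewrite setTI (open_rat_ball oU) preimage_bigcup.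
apply: bigcup_measurable => k _; rewrite /rat_ball.
case: unpickle => [p|]; last by rewrite preimage_set0.
rewrite (_ : f @^-1` _ = \bigcap_(i in [set: 'I_d])
    [set x | `|ratr (p.1 0 i) - (f x : V) 0 i| < p.2.+1%:R^-1]).
  apply: fin_bigcap_measurable => // i _.
  have := @measurable_fun_ltr _ _ R setT
    (fun x => `|ratr (p.1 0 i) - (f x : V) 0 i|) (cst p.2.+1%:R^-1).
  move=> /(_ _ _ measurableT [set true] I); rewrite setTI; apply=> //.
  by apply: measurableT_comp => //; exact: measurable_funB.
apply/seteqP; split=> [x [_ px] i _|x px] /=.
  by have := px 0 i; rewrite /ball/= !mxE.
by split=> // i j; rewrite (ord1 i) mxE; exact: px.
Qed.

Lemma measurable_addrV :
  measurable_fun setT (fun p : BV * BV => (p.1 : V) + (p.2 : V) : BV).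
Proof.
apply: measurable_fun_rV => i; rewrite (_ : (fun _ => _) =
  (fun p : BV * BV => (p.1 : V) 0 i + (p.2 : V) 0 i)); last first.
  by apply/funext => p; rewrite mxE.
by apply: measurable_funD; apply: measurableT_comp (measurable_coord i) _.
Qed.

(** A probability measure is carried by its support, because the complement of
    the support is a countable union of null balls. *)
Lemma msupport_ae (r : probability BV R) : {ae r, forall x, msupport r x}.
Proof.
have rB k : measurable (rat_ball k : set BV).
  by apply: open_measurable_rV; exact: rat_ball_open.
pose N k : set BV := if r (rat_ball k) == 0%E then rat_ball k else set0.
have : r.-negligible (\bigcup_k N k).
  apply: negligible_bigcup => k; rewrite /N.
  case: eqP => [rk|_]; last exact: negligible_set0.
  exists (rat_ball k); split=> //.
apply: negligibleS => x /= /existsNP[U /not_implyP[oU /not_implyP[Ux rU]]].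
have := Ux; rewrite (open_rat_ball oU) => -[k /= kU kx].
exists k => //; rewrite /N ifT//.
rewrite eq_le measure_ge0 andbT leNgt.
apply/negP => rk; apply: rU; apply: lt_le_trans rk _.
by apply: le_measure; rewrite ?inE//; exact: open_measurable_rV.
Qed.

Lemma compact_msupport_ae (r : probability BV R) : compact (msupport r) ->
  exists2 K, 0 <= K & {ae r, forall x, `|x : V| <= K}.
Proof.
move=> /compact_bounded[M [_ Mb]]; exists (`|M| + 1) => //.
have := msupport_ae r; apply: negligibleS => x /=; apply: contra_not => rx.
by apply: Mb rx; rewrite (le_lt_trans (ler_norm M))// ltrDl.
Qed.

End borel_rV_theory.

(** * Functions of exponential type *)

Section exponential_type.
Context {R : realType} {d : nat}.
Local Notation V := 'rV[R]_d.
Local Notation BV := (borel_rV R d).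

(** Measurable functions of at most exponential growth.  They form an algebra and
    are integrable for every measure with finite exponential moments, hence for
    the compound Poisson laws below. *)
Definition exp_type (f : V -> R) : Prop :=
  measurable_fun setT (f : BV -> R) /\
  exists C s : R, [/\ 0 <= C, 0 <= s & forall x, `|f x| <= C * expR (s * `|x|)].

(** The measures that have finite exponential moments of all orders. *)
Definition exp_moments (mu : {measure set BV -> \bar R}) : Prop :=
  forall s : R, (\int[mu]_x (expR (s * `|x : V|))%:E < +oo)%E.

Lemma exp_type_bounded (f : V -> R) C : measurable_fun setT (f : BV -> R) ->
  (forall x, `|f x| <= C) -> exp_type f.
Proof.
move=> mf fC; split=> //; exists C, 0; split=> // [|x].
  by rewrite (le_trans _ (fC 0)).
by rewrite mul0r expR0 mulr1.
Qed.

Lemma exp_type_cst c : exp_type (fun=> c).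
Proof. by apply: (@exp_type_bounded _ `|c|). Qed.

Lemma exp_typeD f g : exp_type f -> exp_type g -> exp_type (fun x => f x + g x).
Proof.
move=> [mf [C [s [C0 s0 fC]]]] [mg [D [u [D0 u0 gD]]]].
split; first exact: measurable_funD.
exists (C + D), (s + u); split=> [||x]; rewrite ?addr_ge0//.
apply: (le_trans (ler_normD _ _)); rewrite mulrDl; apply: lerD.
  apply: (le_trans (fC x)); apply: ler_wpM2l => //.
  by rewrite ler_expR mulrDl lerDl mulr_ge0.
apply: (le_trans (gD x)); apply: ler_wpM2l => //.
by rewrite ler_expR mulrDl lerDr mulr_ge0.
Qed.

Lemma exp_typeM f g : exp_type f -> exp_type g -> exp_type (fun x => f x * g x).
Proof.
move=> [mf [C [s [C0 s0 fC]]]] [mg [D [u [D0 u0 gD]]]].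
split; first exact: measurable_funM.
exists (C * D), (s + u); split=> [||x]; rewrite ?addr_ge0 ?mulr_ge0//.
rewrite normrM mulrDl expRD mulrACA; apply: ler_pM => //.
Qed.

Lemma exp_typeZ c f : exp_type f -> exp_type (fun x => c * f x).
Proof. exact: exp_typeM (exp_type_cst c). Qed.

Lemma exp_type_sum I (s : seq I) (P : pred I) (f : I -> V -> R) :
  (forall i, P i -> exp_type (f i)) -> exp_type (fun x => \sum_(i <- s | P i) f i x).
Proof.
move=> ef; elim: s => [|i s ih].
  by under eq_fun do rewrite big_nil; exact: exp_type_cst.
have [Pi|nPi] := boolP (P i).
  by under eq_fun do rewrite big_cons Pi; apply: exp_typeD => //; exact: ef.
by under eq_fun do rewrite big_cons (negPf nPi).
Qed.

Lemma exp_type_prod I (s : seq I) (P : pred I) (f : I -> V -> R) :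
  (forall i, P i -> exp_type (f i)) -> exp_type (fun x => \prod_(i <- s | P i) f i x).
Proof.
move=> ef; elim: s => [|i s ih].
  by under eq_fun do rewrite big_nil; exact: exp_type_cst.
have [Pi|nPi] := boolP (P i).
  by under eq_fun do rewrite big_cons Pi; apply: exp_typeM => //; exact: ef.
by under eq_fun do rewrite big_cons (negPf nPi).
Qed.

Lemma exp_typeX (f : V -> R) n : exp_type f -> exp_type (fun x => f x ^+ n).
Proof.
move=> ef; elim: n => [|n ih]; first exact: exp_type_cst.
by under eq_fun do rewrite exprS; exact: exp_typeM.
Qed.

Lemma exp_type_expnorm s : exp_type (fun x : V => expR (s * `|x|)).
Proof.
split.
  apply: measurableT_comp => //; apply: measurable_funM => //.
  exact: measurable_norm_rV.
exists 1, `|s|; split=> // x; rewrite mul1r ger0_norm ?expR_ge0// ler_expR.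
by apply: ler_wpM2r => //; exact: ler_norm.
Qed.

Lemma normr_coord (x : V) i : `|x 0 i| <= `|x|.
Proof.
rewrite [leRHS]/Num.norm/= mx_normrE.
exact: (le_bigmax_cond _ (fun ij => `|x ij.1 ij.2|) (j := (0, i))).
Qed.

Lemma exp_type_coord i : exp_type (fun x : V => x 0 i).
Proof.
split; first exact: measurable_coord.
exists 1, 1; split=> // x; rewrite !mul1r (le_trans (normr_coord x i))//.
by rewrite (le_trans _ (expR_ge1Dx _))// lerDr.
Qed.

Lemma normr_dot (eta x : V) : `|dot eta x| <= (\sum_i `|eta 0 i|) * `|x|.
Proof.
rewrite /dot mulr_suml (le_trans (ler_norm_sum _ _ _))//.
by apply: ler_sum => i _; rewrite normrM ler_wpM2l// normr_coord.
Qed.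

Lemma exp_type_dot (eta : V) : exp_type (dot eta).
Proof.
by apply: exp_type_sum => i _; apply: exp_typeZ; exact: exp_type_coord.
Qed.

Lemma exp_type_expdot (eta : V) : exp_type (fun x => expR (dot eta x)).
Proof.
split; first by apply: measurableT_comp => //; exact: (exp_type_dot eta).1.
exists 1, (\sum_i `|eta 0 i|); split=> // [|x]; first exact: sumr_ge0.
rewrite mul1r ger0_norm ?expR_ge0// ler_expR.
by rewrite (le_trans (ler_norm _))// normr_dot.
Qed.

Lemma exp_type_cos (f : V -> R) : measurable_fun setT (f : BV -> R) ->
  exp_type (fun x => cos (f x)).
Proof.
move=> mf; apply: (@exp_type_bounded _ 1) => [|x]; last first.
  by rewrite ler_norml cos_geN1 cos_le1.
exact: measurableT_comp (continuous_measurable_fun (@continuous_cos R)) mf.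
Qed.

Lemma exp_type_sin (f : V -> R) : measurable_fun setT (f : BV -> R) ->
  exp_type (fun x => sin (f x)).
Proof.
move=> mf; apply: (@exp_type_bounded _ 1) => [|x]; last first.
  by rewrite ler_norml sin_geN1 sin_le1.
exact: measurableT_comp (continuous_measurable_fun (@continuous_sin R)) mf.
Qed.

Lemma exp_type_integrable (mu : {measure set BV -> \bar R}) f :
  exp_moments mu -> exp_type f -> mu.-integrable setT (EFin \o f).
Proof.
move=> emu [mf [C [s [C0 s0 fC]]]].
apply: (@le_integrable _ BV R mu setT measurableT _
  (fun x : BV => C%:E * (expR (s * `|x : V|))%:E)%E).
- exact/measurable_EFinP.
- move=> x _ /=; rewrite lee_fin [leRHS]ger0_norm; first exact: fC.
  by rewrite mulr_ge0// expR_ge0.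
- apply: integrableZl => //; apply/integrableP; split.
    by apply/measurable_EFinP; have [] := exp_type_expnorm s.
  under eq_integral do rewrite gee0_abs ?lee_fin ?expR_ge0//.
  exact: emu.
Qed.

(** Exponential type is preserved by translations, with a bound that is a
    product of functions of each variable. *)
Lemma exp_type_shift_ub (f : V -> R) : exp_type f -> exists C s,
  forall x y, `|f (x + y)| <= C * expR (s * `|x|) * expR (s * `|y|).
Proof.
move=> [mf [C [s [C0 s0 fC]]]]; exists C, s => x y.
rewrite (le_trans (fC _))// -mulrA -expRD -mulrDr ler_wpM2l// ler_expR.
by rewrite ler_wpM2l// ler_normD.
Qed.

Lemma ae_bounded_exp_moments (r : probability BV R) K :
  {ae r, forall x, `|x : V| <= K} -> exp_moments r.
Proof.
move=> rK s; apply: (@le_lt_trans _ _ (\int[r]_x (expR (`|s| * K))%:E)%E).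
  apply: ae_ge0_le_integral => //.
  - by apply/measurable_EFinP; have [] := exp_type_expnorm s.
  - move: rK; apply: negligibleS => x /=; apply: contra_not => xK _.
    rewrite lee_fin ler_expR (@le_trans _ _ (`|s| * `|x : V|))//.
      by rewrite ler_wpM2r// ler_norm.
    exact: ler_wpM2l.
by rewrite integral_cst//= probability_setT mule1 ltry.
Qed.

End exponential_type.

(** * Sums of independent random vectors *)

Section product_probability.
Context {d1 d2} {T1 : measurableType d1} {T2 : measurableType d2} {R : realType}.
Variables (P : probability T1 R) (Q : probability T2 R).

(** The product of two probability measures, as a probability measure. *)
Definition prod_prob : set (T1 * T2) -> \bar R := (P \x Q)%E.

HB.instance Definition _ := Measure.on prod_prob.

Let prod_prob_setT : prod_prob setT = 1%E.
Proof.
rewrite /prod_prob -setXTT product_measure1E//.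
rewrite [X in (X * _)%E](probability_setT P) [X in (_ * X)%E](probability_setT Q).
by rewrite mule1.
Qed.

HB.instance Definition _ :=
  Measure_isProbability.Build _ _ _ prod_prob prod_prob_setT.

End product_probability.

Section convolution.
Context {R : realType} {d : nat}.
Local Notation V := 'rV[R]_d.
Local Notation BV := (borel_rV R d).

Definition add_rV (p : BV * BV) : BV := (p.1 : V) + (p.2 : V).

HB.instance Definition _ :=
  isMeasurableFun.Build _ _ _ _ add_rV measurable_addrV.

(** The law of the sum of two independent random vectors. *)
Definition law_add (m r : probability BV R) : probability BV R :=
  distribution (prod_prob m r) add_rV.

Variables m r : probability BV R.

Lemma measurable_add_rV (f : BV -> \bar R) : measurable_fun setT f ->
  measurable_fun setT (f \o add_rV).
Proof. by move=> mf; apply: measurableT_comp => //; exact: measurable_addrV. Qed.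

Lemma measurable_shift (f : BV -> \bar R) (x : BV) : measurable_fun setT f ->
  measurable_fun setT (fun y : BV => f ((x : V) + (y : V))).
Proof.
move=> mf; have mx : measurable_fun setT (fun y : BV => (x : V) + (y : V) : BV).
  apply: measurable_fun_rV => i; under eq_fun do rewrite mxE.
  by apply: measurable_funD => //; exact: measurable_coord.
exact: measurableT_comp mf mx.
Qed.

Lemma measurable_integral_shift (f : BV -> \bar R) : measurable_fun setT f ->
  (forall x, (0 <= f x)%E) ->
  measurable_fun setT (fun x : BV => \int[r]_y f ((x : V) + (y : V))%R)%E.
Proof.
move=> mf f0; have := @measurable_fun_fubini_tonelli_F _ _ _ _ _ r (f \o add_rV)
  (measurable_add_rV mf).
by apply=> p; exact: f0.
Qed.

Lemma ge0_integral_law_add (f : BV -> \bar R) :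
  measurable_fun setT f -> (forall x, (0 <= f x)%E) ->
  (\int[law_add m r]_x f x =
   \int[m]_x \int[r]_y f ((x : V) + (y : V))%R)%E.
Proof.
move=> mf f0; rewrite /law_add ge0_integral_distribution//.
rewrite /prod_prob fubini_tonelli1//; first exact: measurable_add_rV.
by move=> p; exact: f0.
Qed.

Lemma exp_moments_law_add_le (s q : R) :
  (\int[r]_y (expR (s * `|y : V|))%:E <= q%:E)%E -> 0 <= s ->
  (\int[law_add m r]_x (expR (s * `|x : V|))%:E <=
   q%:E * \int[m]_x (expR (s * `|x : V|))%:E)%E.
Proof.
move=> rq s0; have mes : measurable_fun setT
    (fun x : BV => (expR (s * `|x : V|))%:E).
  by apply/measurable_EFinP; have [] := @exp_type_expnorm R d s.
have q0 : (0 <= q%:E)%E.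
  by apply: le_trans rq; apply: integral_ge0 => x _; rewrite lee_fin expR_ge0.
rewrite ge0_integral_law_add//.
rewrite -ge0_integralZl//.
apply: ge0_le_integral => //.
- by move=> x _; apply: integral_ge0 => y _; rewrite lee_fin expR_ge0.
- by apply: (measurable_integral_shift (f := fun x : BV => (expR (s * `|x : V|))%:E)).
- exact: measurable_funeM.
- move=> x _; rewrite muleC.
  apply: (@le_trans _ _ (\int[r]_y ((expR (s * `|x : V|))%:E * (expR (s * `|y : V|))%:E))%E).
    apply: ge0_le_integral => //.
    + exact: (measurable_shift (f := fun x : BV => (expR (s * `|x : V|))%:E)).
    + exact: measurable_funeM.
    + move=> y _; rewrite -EFinM lee_fin -expRD ler_expR -mulrDr ler_wpM2l//.
      exact: ler_normD.
  by rewrite ge0_integralZl// lee_wpmul2l.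
Qed.

Hypotheses (em : exp_moments m) (er : exp_moments r).

Lemma exp_moments_law_add : exp_moments (law_add m r).
Proof.
move=> s; apply: (@le_lt_trans _ _
    (\int[law_add m r]_x (expR (`|s| * `|x : V|))%:E)%E).
  apply: ge0_le_integral => //.
  - by apply/measurable_EFinP; have [] := @exp_type_expnorm R d s.
  - by apply/measurable_EFinP; have [] := @exp_type_expnorm R d `|s|.
  - by move=> x _; rewrite lee_fin ler_expR ler_wpM2r// ler_norm.
have rfin : (\int[r]_y (expR (`|s| * `|y : V|))%:E)%E \is a fin_num.
  by rewrite ge0_fin_numE ?er// integral_ge0.
apply: (@le_lt_trans _ _ _ _ _ (@exp_moments_law_add_le `|s|
  (fine (\int[r]_y (expR (`|s| * `|y : V|))%:E)%E) _ _)) => //.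
  by rewrite fineK.
by rewrite lte_mul_pinfty// lee_fin fine_ge0// integral_ge0.
Qed.

Lemma exp_type_shift (f : V -> R) x : exp_type f -> exp_type (fun y => f (x + y)).
Proof.
move=> ef; have [C [s fC]] := exp_type_shift_ub ef; have [mf _] := ef.
split.
  apply/measurable_EFinP; apply: (measurable_shift (f := EFin \o f) x).
  exact/measurable_EFinP.
exists (`|C| * expR (s * `|x|)), `|s|; split=> // y.
rewrite (le_trans (fC _ _))//; apply: (@le_trans _ _
    (`|C| * expR (s * `|x|) * expR (s * `|y|))).
  by rewrite ler_wpM2r ?expR_ge0// ler_wpM2r ?expR_ge0// ler_norm.
rewrite ler_wpM2l ?mulr_ge0 ?expR_ge0//.
by rewrite ler_expR ler_wpM2r// ler_norm.
Qed.

Lemma integral_law_add (f : V -> R) : exp_type f ->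
  \int[law_add m r]_x f x = \int[m]_x \int[r]_y f (x + y).
Proof.
move=> ef; have [mf _] := ef; have iF := exp_type_integrable exp_moments_law_add ef.
have mF : measurable_fun setT (EFin \o (f : BV -> R)) by exact/measurable_EFinP.
have iP : (prod_prob m r).-integrable setT ((EFin \o f) \o add_rV).
  apply/integrableP; split; first exact: measurable_add_rV.
  have /integrableP[_] := iF.
  rewrite /law_add ge0_integral_distribution//.
  exact: measurableT_comp.
rewrite /Rintegral /law_add integral_distribution// /prod_prob.
rewrite -(integral12_prod_meas1 iP); congr fine; apply: eq_integral => x _ /=.
rewrite /fubini_F/= fineK//; apply: integrable_fin_num => //.
exact: exp_type_integrable er (exp_type_shift x ef).
Qed.

End convolution.

(** * Compound Poisson laws *)

Section nonneg_series.
Context {R : realType}.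

Lemma eseries_EFin (u : R^nat) n :
  (\sum_(0 <= k < n) (u k)%:E = (series u n)%:E)%E.
Proof. by rewrite sumEFin. Qed.

Lemma nneseries_cvg_EFin (u : R^nat) l :
  series u @ \oo --> l -> (\sum_(n <oo) (u n)%:E = l%:E)%E.
Proof.
move=> ul; apply/cvg_lim => //; under eq_cvg do rewrite eseries_EFin.
by apply: cvg_EFin => //; exact: nearW.
Qed.

Lemma cvg_nneseries_EFin (u : R^nat) l : (forall n, 0 <= u n) ->
  (\sum_(n <oo) (u n)%:E = l%:E)%E -> series u @ \oo --> l.
Proof.
move=> u0 ul; have := @is_cvg_nneseries R (EFin \o u) xpredT 0%N.
have u0' n : (0 <= n)%N -> true -> (0 <= (EFin \o u) n)%E.
  by move=> _ _; rewrite lee_fin.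
move=> /(_ u0') /cvg_ex[l' /= ul']; have : l' = l%:E.
  by rewrite -ul; apply/esym/cvg_lim.
move: ul' => /[swap] -> ; under eq_cvg do rewrite eseries_EFin.
by move/fine_cvg.
Qed.

Lemma cvg_series_expR (x : R) : series (fun n => x ^+ n / n`!%:R) @ \oo --> expR x.
Proof. exact: is_cvg_series_exp_coeff. Qed.

End nonneg_series.

Section compound_poisson.
Context {R : realType} {d : nat}.
Local Notation V := 'rV[R]_d.
Local Notation BV := (borel_rV R d).
Variables (x0 : V) (lam : {nonneg R}) (r : probability BV R).

(** The law of [x0] plus [n] independent jumps of law [r]. *)
Fixpoint jump_law (n : nat) : probability BV R :=
  if n is n'.+1 then law_add (jump_law n') r else dirac (x0 : BV).

(** The probability of [n] under the Poisson law of mean [lam]. *)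
Definition poisson_weight (n : nat) : R :=
  expR (- lam%:num) * (lam%:num ^+ n / n`!%:R).

Lemma poisson_weight_ge0 n : 0 <= poisson_weight n.
Proof. by rewrite mulr_ge0 ?expR_ge0// divr_ge0// exprn_ge0. Qed.

(** The law of [x0] plus a Poisson number, of mean [lam], of independent jumps
    of law [r]. *)
Definition compound_poisson : set BV -> \bar R :=
  mseries (fun n => mscale (NngNum (poisson_weight_ge0 n)) (jump_law n)) 0.

HB.instance Definition _ := Measure.on compound_poisson.

Lemma cvg_poisson_weight (q : R) :
  series (fun n => poisson_weight n * q ^+ n) @ \oo -->
  expR (lam%:num * (q - 1)).
Proof.
rewrite mulrBr mulr1 addrC expRD.
rewrite (_ : series _ = (fun n => expR (- lam%:num) *
    series (fun n => (lam%:num * q) ^+ n / n`!%:R) n)).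
  by apply: cvgMl_tmp; exact: cvg_series_expR.
apply/funext => n; rewrite /series/= mulr_sumr; apply: eq_bigr => i _.
by rewrite exprMn /poisson_weight -!mulrA [q ^+ _ / _]mulrC.
Qed.

Let compound_poisson_setT : compound_poisson setT = 1%E.
Proof.
rewrite /compound_poisson /mseries.
rewrite (eq_eseriesr (g := fun n => (poisson_weight n)%:E)); last first.
  move=> n _; transitivity ((poisson_weight n)%:E * jump_law n setT)%E => //.
  by rewrite probability_setT mule1.
apply: nneseries_cvg_EFin; have := @cvg_poisson_weight 1.
rewrite subrr mulr0 expR0; by under eq_fun do rewrite expr1n mulr1.
Qed.

HB.instance Definition _ :=
  Measure_isProbability.Build _ _ _ compound_poisson compound_poisson_setT.

Lemma ge0_integral_compound_poisson (f : BV -> \bar R) :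
  measurable_fun setT f -> (forall x, (0 <= f x)%E) ->
  (\int[compound_poisson]_x f x =
   \sum_(n <oo) ((poisson_weight n)%:E * \int[jump_law n]_x f x))%E.
Proof.
move=> mf f0; rewrite /compound_poisson ge0_integral_measure_series//.
by apply: eq_eseriesr => n _; rewrite ge0_integral_mscale.
Qed.

Hypothesis er : exp_moments r.

Lemma exp_moments_dirac (x : BV) : exp_moments (\d_x : {measure set BV -> \bar R}).
Proof.
move=> s; rewrite integral_dirac//= ?diracT ?mul1e ?ltry//.
by apply/measurable_EFinP; have [] := @exp_type_expnorm R d s.
Qed.

Lemma exp_moments_jump_law n : exp_moments (jump_law n).
Proof.
elim: n => [|n ih] /=; first exact: exp_moments_dirac.
exact: exp_moments_law_add.
Qed.

Lemma exp_moments_compound_poisson : exp_moments compound_poisson.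
Proof.
move=> s; apply: (@le_lt_trans _ _
    (\int[compound_poisson]_x (expR (`|s| * `|x : V|))%:E)%E).
  apply: ge0_le_integral => //.
  - by apply/measurable_EFinP; have [] := @exp_type_expnorm R d s.
  - by apply/measurable_EFinP; have [] := @exp_type_expnorm R d `|s|.
  - by move=> x _; rewrite lee_fin ler_expR ler_wpM2r// ler_norm.
have mes : measurable_fun setT (fun x : BV => (expR (`|s| * `|x : V|))%:E).
  by apply/measurable_EFinP; have [] := @exp_type_expnorm R d `|s|.
pose q := fine (\int[r]_y (expR (`|s| * `|y : V|))%:E)%E.
have rfin : (\int[r]_y (expR (`|s| * `|y : V|))%:E)%E \is a fin_num.
  by rewrite ge0_fin_numE ?er// integral_ge0.
have q0 : 0 <= q by rewrite fine_ge0// integral_ge0.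
have jq n : (\int[jump_law n]_x (expR (`|s| * `|x : V|))%:E <=
             (expR (`|s| * `|x0|) * q ^+ n)%:E)%E.
  elim: n => [|n ih] /=.
    by rewrite integral_dirac//= diracT mul1e expr0 mulr1.
  apply: (le_trans (@exp_moments_law_add_le _ _ _ _ `|s| q _ _)) => //.
    by rewrite fineK.
  rewrite exprS mulrCA [leRHS]EFinM; apply: lee_wpmul2l => //.
rewrite ge0_integral_compound_poisson//.
apply: (@le_lt_trans _ _ (\sum_(n <oo)
    (expR (`|s| * `|x0|) * (poisson_weight n * q ^+ n))%:E)%E).
  apply: lee_nneseries => n _.
    by rewrite mule_ge0 ?lee_fin ?poisson_weight_ge0 ?integral_ge0.
  by rewrite mulrCA [leRHS]EFinM; apply: lee_wpmul2l => //; rewrite lee_fin poisson_weight_ge0.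
rewrite (@nneseries_cvg_EFin _ _ (expR (`|s| * `|x0|) * expR (lam%:num * (q - 1)))) ?ltry//.
rewrite (_ : series _ = (fun n => expR (`|s| * `|x0|) *
    series (fun n => poisson_weight n * q ^+ n) n)).
  by apply: cvgMl_tmp; exact: cvg_poisson_weight.
by apply/funext => n; rewrite /series/= mulr_sumr.
Qed.

Lemma ge0_cvg_compound_poisson (f : V -> R) : exp_type f -> (forall x, 0 <= f x) ->
  series (fun n => poisson_weight n * \int[jump_law n]_x f x) @ \oo -->
  \int[compound_poisson]_x f x.
Proof.
move=> ef f0; have [mf _] := ef.
apply: cvg_nneseries_EFin => [n|].
  by rewrite mulr_ge0 ?poisson_weight_ge0// Rintegral_ge0.
have icp := exp_type_integrable exp_moments_compound_poisson ef.
rewrite [RHS]fineK; last exact: integrable_fin_num.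
rewrite ge0_integral_compound_poisson//; last exact/measurable_EFinP.
apply: eq_eseriesr => n _; rewrite EFinM; congr (_ * _)%E.
rewrite [LHS]fineK//; apply: integrable_fin_num => //.
exact: exp_type_integrable (exp_moments_jump_law n) ef.
Qed.

(** The mean under a compound Poisson law is the Poisson mixture of the means for
    a given number of jumps.  Signed functions are reduced to nonnegative ones by
    adding an exponential bound. *)
Lemma cvg_compound_poisson (f : V -> R) : exp_type f ->
  series (fun n => poisson_weight n * \int[jump_law n]_x f x) @ \oo -->
  \int[compound_poisson]_x f x.
Proof.
move=> ef; have [mf [C [s [C0 s0 fC]]]] := ef.
pose g (x : V) := C * expR (s * `|x|).
have eg : exp_type g by apply: exp_typeZ; exact: exp_type_expnorm.
have g0 x : 0 <= g x by rewrite mulr_ge0 ?expR_ge0.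
have efg : exp_type (fun x => f x + g x) by exact: exp_typeD.
have fg0 x : 0 <= f x + g x.
  by have := fC x; rewrite ler_norml => /andP[+ _]; rewrite -subr_ge0 opprK.
have emP := exp_moments_compound_poisson.
have := cvgB (ge0_cvg_compound_poisson efg fg0) (ge0_cvg_compound_poisson eg g0).
rewrite RintegralD//; [|exact: exp_type_integrable..]; rewrite addrK.
set A := (A in A @ _ --> _).
rewrite (_ : A = series (fun n => poisson_weight n * \int[jump_law n]_x f x))//.
  by apply.
apply/funext => n; rewrite /A fctE /series/= -sumrB; apply: eq_bigr => i _.
rewrite RintegralD//; [|exact: (exp_type_integrable (exp_moments_jump_law i))..].
by rewrite mulrDr addrK.
Qed.

End compound_poisson.

(** * Real power series and the complex exponential *)

Lemma cvgn_ext {R : realType} (u v : R^nat) (l : R) :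
  u @ \oo --> l -> (forall n, v n = u n) -> v @ \oo --> l.
Proof. by move=> ul vu; rewrite (_ : v = u)//; apply/funext. Qed.

Lemma cvgn_prod {R : realType} (I : Type) (s : seq I) (u : I -> R^nat) (l : I -> R) :
  (forall i, u i @ \oo --> l i) ->
  (fun n => \prod_(i <- s) u i n) @ \oo --> \prod_(i <- s) l i.
Proof.
move=> ul; elim: s => [|i s ih].
  have h : (fun=> 1) @ \oo --> (1 : R) by exact: cvg_cst.
  by rewrite big_nil; apply: (cvgn_ext h) => n; rewrite big_nil.
have h : (fun n => u i n * \prod_(j <- s) u j n) @ \oo -->
  l i * \prod_(j <- s) l j by exact: cvgM.
by rewrite big_cons; apply: (cvgn_ext h) => n; rewrite big_cons.
Qed.

Lemma cvgn_dist {R : realType} (u v : R^nat) (l : R) :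
  (forall n, `|u n - l| <= v n) -> v @ \oo --> 0 -> u @ \oo --> l.
Proof.
move=> uv v0; apply/cvgrPdist_le => e e0.
have /cvgrPdist_le /(_ _ e0) := v0; apply: filterS => n.
rewrite sub0r normrN distrC => ve.
exact: le_trans (uv n) (le_trans (ler_norm _) ve).
Qed.

Section exp_bounded_pseries.
Context {R : realType}.
Implicit Types (f : R^nat) (x : R).

(** Coefficients dominated by those of an exponential. *)
Definition exp_bounded f := exists C M : R,
  [/\ 0 <= C, 0 <= M & forall n, `|f n| <= C * (M ^+ n / n`!%:R)].

Lemma exp_bounded_cvg_norm f x : exp_bounded f ->
  cvgn (series (fun n => `|f n * x ^+ n|)).
Proof.
move=> [C [M [C0 M0 fC]]].
apply: (@series_le_cvg _ _ (fun n => C *: exp_coeff (M * `|x|) n)) => //.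
- by move=> n; rewrite /exp_coeff/= /GRing.scale/= mulr_ge0// divr_ge0// exprn_ge0 ?mulr_ge0.
- move=> n; rewrite normrM normrX /exp_coeff/= /GRing.scale/= exprMn.
  rewrite [leRHS](_ : _ = C * (M ^+ n / n`!%:R) * `|x| ^+ n).
    by rewrite ler_wpM2r// exprn_ge0.
  by rewrite -!mulrA; congr (_ * (_ * _)); rewrite mulrC.
- apply: is_cvg_seriesZ; exact: is_cvg_series_exp_coeff.
Qed.

Lemma exp_bounded_cvg f x : exp_bounded f -> cvgn (pseries f x).
Proof. by move=> ef; apply: normed_cvg; exact: exp_bounded_cvg_norm. Qed.

Lemma exp_bounded_diffs f : exp_bounded f -> exp_bounded (pseries_diffs f).
Proof.
move=> [C [M [C0 M0 fC]]]; exists (C * M), M; split; rewrite ?mulr_ge0// => n.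
rewrite /pseries_diffs normrM ger0_norm//.
apply: (le_trans (ler_wpM2l _ (fC n.+1))) => //.
rewrite factS natrM exprS le_eqVlt; apply/orP; left; apply/eqP.
by field; rewrite nat1r !pnatr_eq0 -lt0n fact_gt0.
Qed.

Lemma is_derive_pseries f x : exp_bounded f ->
  is_derive x (1 : R) (fun y => limn (pseries f y))
    (limn (pseries (pseries_diffs f) x)).
Proof.
move=> ef; apply: (@pseries_snd_diffs _ _ (`|x| + 1)).
- exact: exp_bounded_cvg.
- by apply/exp_bounded_cvg/exp_bounded_diffs.
- by apply/exp_bounded_cvg/exp_bounded_diffs/exp_bounded_diffs.
- by rewrite [ltRHS]ger0_norm// ltrDl.
Qed.

Lemma pseries0 f : limn (pseries f 0) = f 0%N.
Proof.
apply/cvg_lim => //; rewrite -cvg_shiftS.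
rewrite (_ : (fun n => _) = (fun=> f 0%N)); first exact: cvg_cst.
apply/funext => n; rewrite /pseries/= /series/= big_nat_recl// expr0 mulr1.
by rewrite big1 ?addr0// => i _; rewrite exprS mul0r mulr0.
Qed.

End exp_bounded_pseries.

Section derivative_rules.
Context {R : realType}.
Implicit Types (f g : R -> R) (x s : R).

Lemma is_derive_mulM s x : is_derive x (1 : R) (fun y => s * y) s.
Proof.
have := is_deriveZ s (is_derive_id x (1 : R)).
by rewrite /GRing.scale/= mulr1.
Qed.

Lemma is_derive_comp_mulM f s x df : is_derive (s * x) (1 : R) f df ->
  is_derive x (1 : R) (fun y => f (s * y)) (s * df).
Proof.
move=> fd; rewrite mulrC.
exact: (@is_derive1_comp R f (fun y => s * y) x df s fd (is_derive_mulM s x)).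
Qed.

Lemma is_derive_mul f g x df dg : is_derive x (1 : R) f df ->
  is_derive x (1 : R) g dg ->
  is_derive x (1 : R) (fun y => f y * g y) (df * g x + f x * dg).
Proof.
move=> fd gd; rewrite addrC [df * _]mulrC; exact: (is_deriveM fd gd).
Qed.

Lemma is_derive_add f g x df dg : is_derive x (1 : R) f df ->
  is_derive x (1 : R) g dg ->
  is_derive x (1 : R) (fun y => f y + g y) (df + dg).
Proof. by move=> fd gd; exact: (is_deriveD fd gd). Qed.

Lemma is_derive_opp f x df : is_derive x (1 : R) f df ->
  is_derive x (1 : R) (fun y => - f y) (- df).
Proof. by move=> fd; exact: (is_deriveN fd). Qed.

Lemma is_derive_const (c : R) x : is_derive x (1 : R) (fun=> c) 0.
Proof. exact: is_derive_cst. Qed.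

Lemma is_derive_ident x : is_derive x (1 : R) (fun y => y) 1.
Proof. exact: is_derive_id. Qed.

Lemma is_derive_conv f x df dg : is_derive x (1 : R) f df -> df = dg ->
  is_derive x (1 : R) f dg.
Proof. by move=> ? <-. Qed.

End derivative_rules.

Section complex_exponential_series.
Context {R : realType}.
Local Open Scope complex_scope.
Implicit Types (z w : R[i]) (x : R).

Lemma complex_ReM z w : complex.Re (z * w) =
  complex.Re z * complex.Re w - complex.Im z * complex.Im w.
Proof. by case: z => a b; case: w. Qed.

Lemma complex_ImM z w : complex.Im (z * w) =
  complex.Re z * complex.Im w + complex.Im z * complex.Re w.
Proof. by case: z => a b; case: w. Qed.

Let M z : R := `|complex.Re z| + `|complex.Im z|.

Let M_ge0 z : 0 <= M z. Proof. exact: addr_ge0. Qed.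

Let normr_ReIm_expr z n :
  `|complex.Re (z ^+ n)| + `|complex.Im (z ^+ n)| <= M z ^+ n.
Proof.
elim: n => [|n ih]; first by rewrite !expr0/= normr1 normr0 addr0.
rewrite exprS complex_ReM complex_ImM exprS; apply: le_trans (ler_wpM2l (M_ge0 z) ih).
apply: (le_trans (lerD (ler_normB _ _) (ler_normD _ _))).
by rewrite !normrM /M; lra.
Qed.

Let pre z n : R := complex.Re (z ^+ n) / n`!%:R.
Let pim z n : R := complex.Im (z ^+ n) / n`!%:R.

Let bounded_pre z : exp_bounded (pre z).
Proof.
exists 1, (M z); split=> // n; rewrite mul1r normrM [`|_^-1|]ger0_norm//.
by rewrite ler_wpM2r// (le_trans _ (normr_ReIm_expr z n))// lerDl.
Qed.

Let bounded_pim z : exp_bounded (pim z).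
Proof.
exists 1, (M z); split=> // n; rewrite mul1r normrM [`|_^-1|]ger0_norm//.
by rewrite ler_wpM2r// (le_trans _ (normr_ReIm_expr z n))// lerDr.
Qed.

Let fact_neq0 n : n`!%:R != 0 :> R.
Proof. by rewrite pnatr_eq0 -lt0n fact_gt0. Qed.

Let diffs_pre z : pseries_diffs (pre z) =
  complex.Re z *: pre z - complex.Im z *: pim z.
Proof.
apply/funext => n; rewrite /pseries_diffs /pre /pim exprS complex_ReM factS natrM.
rewrite !fctE /GRing.scale/=.
by field; rewrite fact_neq0 nat1r pnatr_eq0.
Qed.

Let diffs_pim z : pseries_diffs (pim z) =
  complex.Re z *: pim z + complex.Im z *: pre z.
Proof.
apply/funext => n; rewrite /pseries_diffs /pre /pim exprS complex_ImM factS natrM.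
rewrite !fctE /GRing.scale/=.
by field; rewrite fact_neq0 nat1r pnatr_eq0.
Qed.

Let pseriesE (f g : R^nat) (a b : R) x : exp_bounded f -> exp_bounded g ->
  limn (pseries (a *: f + b *: g) x) =
  a * limn (pseries f x) + b * limn (pseries g x).
Proof.
move=> ef eg.
have cf : cvgn (series (fun n => f n * x ^+ n)) by exact: (exp_bounded_cvg ef).
have cg : cvgn (series (fun n => g n * x ^+ n)) by exact: (exp_bounded_cvg eg).
rewrite (_ : pseries _ x = series (a *: (fun n => f n * x ^+ n) + b *: (fun n => g n * x ^+ n))).
  by rewrite lim_seriesD; [rewrite !lim_seriesZ|exact: is_cvg_seriesZ|exact: is_cvg_seriesZ].
apply/funext => n; rewrite /pseries/= /series/=; apply: eq_bigr => i _.
by rewrite !fctE /GRing.scale/= mulrDl !mulrA.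
Qed.

Let F z x := limn (pseries (pre z) x).
Let G z x := limn (pseries (pim z) x).

Let dF z x : is_derive x (1 : R) (F z) (complex.Re z * F z x - complex.Im z * G z x).
Proof.
apply: is_derive_eq; first exact: is_derive_pseries.
by rewrite diffs_pre -scaleNr pseriesE// mulNr.
Qed.

Let dG z x : is_derive x (1 : R) (G z) (complex.Re z * G z x + complex.Im z * F z x).
Proof.
apply: is_derive_eq; first exact: is_derive_pseries.
by rewrite diffs_pim pseriesE.
Qed.

(** With [z = c + i s], both [exp(- c x) (F cos(s x) + G sin(s x))] and
    [exp(- c x) (G cos(s x) - F sin(s x))] have zero derivative. *)
Let FGE z x :
  F z x = expR (complex.Re z * x) * cos (complex.Im z * x) /\
  G z x = expR (complex.Re z * x) * sin (complex.Im z * x).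
Proof.
pose c := complex.Re z; pose s := complex.Im z.
pose H1 (y : R) := expR (- c * y) * (F z y * cos (s * y) + G z y * sin (s * y)).
pose H2 (y : R) := expR (- c * y) * (G z y * cos (s * y) - F z y * sin (s * y)).
have dexp y := is_derive_comp_mulM (is_derive_expR (- c * y)).
have dcos y := is_derive_comp_mulM (is_derive_cos (s * y)).
have dsin y := is_derive_comp_mulM (is_derive_sin (s * y)).
have H1x : H1 x = H1 0.
  apply: is_derive_0_is_cst => y.
  refine (is_derive_conv (is_derive_mul (dexp y) (is_derive_add
    (is_derive_mul (dF z y) (dcos y)) (is_derive_mul (dG z y) (dsin y)))) _).
  by rewrite -/c -/s; ring.
have H2x : H2 x = H2 0.
  apply: is_derive_0_is_cst => y.
  refine (is_derive_conv (is_derive_mul (dexp y) (is_derive_add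
    (is_derive_mul (dG z y) (dcos y))
    (is_derive_opp (is_derive_mul (dF z y) (dsin y))))) _).
  by rewrite -/c -/s; ring.
have F0 : F z 0 = 1 by rewrite /F pseries0 /pre expr0 divr1.
have G0 : G z 0 = 0 by rewrite /G pseries0 /pim expr0 mul0r.
move: H1x H2x; rewrite /H1 /H2 F0 G0 !mulr0 expR0 cos0 sin0 mulr0 mulr1 addr0.
rewrite mulr1 mul0r mulr0 subrr mulr0 => H1x H2x.
have ee : expR (c * x) * expR (- c * x) = 1 by rewrite -expRD mulNr subrr expR0.
have := cos2Dsin2 (s * x); set C := cos _ in H1x H2x *; set S := sin _ in H1x H2x *.
move: ee H1x H2x; set E := expR (c * x); set E' := expR (- c * x) => ee h1 h2 cs.
split.
- transitivity (E * E' * F z x * (C ^+ 2 + S ^+ 2)); first by rewrite ee cs; ring.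
  transitivity (E * ((E' * (F z x * C + G z x * S)) * C -
    (E' * (G z x * C - F z x * S)) * S)); first by ring.
  by rewrite h1 h2; ring.
- transitivity (E * E' * G z x * (C ^+ 2 + S ^+ 2)); first by rewrite ee cs; ring.
  transitivity (E * ((E' * (F z x * C + G z x * S)) * S +
    (E' * (G z x * C - F z x * S)) * C)); first by ring.
  by rewrite h1 h2; ring.
Qed.

(** The real part of [exp(z x)], as a power series in [x]. *)
Lemma cvg_series_Re_cexp z x :
  series (fun n => complex.Re (z ^+ n) / n`!%:R * x ^+ n) @ \oo -->
  expR (complex.Re z * x) * cos (complex.Im z * x).
Proof.
have [<- _] := FGE z x; exact: (exp_bounded_cvg (x := x) (bounded_pre z)).
Qed.

(** The imaginary part of [exp(z x)], as a power series in [x]. *)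
Lemma cvg_series_Im_cexp z x :
  series (fun n => complex.Im (z ^+ n) / n`!%:R * x ^+ n) @ \oo -->
  expR (complex.Re z * x) * sin (complex.Im z * x).
Proof.
have [_ <-] := FGE z x; exact: (exp_bounded_cvg (x := x) (bounded_pim z)).
Qed.

End complex_exponential_series.

(** * Transforms of compound Poisson laws *)

Section dot_theory.
Context {K : comPzRingType} {d : nat}.
Implicit Types (u v w : 'rV[K]_d).

Lemma dotDr u v w : dot u (v + w) = dot u v + dot u w.
Proof.
by rewrite /dot -big_split; apply: eq_bigr => i _; rewrite mxE mulrDr.
Qed.

Lemma dotDl u v w : dot (u + v) w = dot u w + dot v w.
Proof.
by rewrite /dot -big_split; apply: eq_bigr => i _; rewrite mxE mulrDl.
Qed.

Lemma dotC u v : dot u v = dot v u.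
Proof. by apply: eq_bigr => i _; rewrite mulrC. Qed.

Lemma dotZl c u v : dot (c *: u) v = c * dot u v.
Proof. by rewrite /dot mulr_sumr; apply: eq_bigr => i _; rewrite mxE mulrA. Qed.

Lemma dotNl u v : dot (- u) v = - dot u v.
Proof. by rewrite -scaleN1r dotZl mulN1r. Qed.

Lemma dotNr u v : dot u (- v) = - dot u v.
Proof. by rewrite dotC dotNl dotC. Qed.

Lemma dot0l v : dot 0 v = 0.
Proof. by rewrite /dot big1// => i _; rewrite mxE mul0r. Qed.

End dot_theory.

Section compound_poisson_transforms.
Context {R : realType} {d : nat}.
Local Notation V := 'rV[R]_d.
Local Notation BV := (borel_rV R d).
Variables (x0 : V) (lam : {nonneg R}) (r : probability BV R).
Hypothesis er : exp_moments r.
Local Notation jump n := (jump_law x0 r n).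
Local Notation cp := (compound_poisson x0 lam r).
Implicit Types (eta xi : V).

Lemma Rintegral_dirac (x : BV) (f : V -> R) : measurable_fun setT (f : BV -> R) ->
  \int[\d_x]_y f y = f x.
Proof.
move=> mf; have mf' : measurable_fun setT (EFin \o (f : BV -> R)) by exact/measurable_EFinP.
by rewrite /Rintegral (integral_dirac _ measurableT mf') diracT mul1e.
Qed.

Lemma jump_law_mgf eta n : \int[jump n]_x expR (dot eta x) =
  expR (dot eta x0) * (\int[r]_y expR (dot eta y)) ^+ n.
Proof.
elim: n => [|n ih] /=.
  by rewrite Rintegral_dirac ?expr0 ?mulr1//; have [] := exp_type_expdot eta.
have ej := exp_moments_jump_law x0 er n.
rewrite integral_law_add//; last exact: exp_type_expdot.
transitivity (\int[jump n]_x (expR (dot eta x) * \int[r]_y expR (dot eta y))).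
  apply: eq_Rintegral => x _.
  under eq_Rintegral do rewrite dotDr expRD.
  by rewrite RintegralZl//; exact: exp_type_integrable er (exp_type_expdot eta).
rewrite RintegralZr//; last exact: exp_type_integrable ej (exp_type_expdot eta).
by rewrite ih exprSr mulrA.
Qed.

Lemma compound_poisson_mgf eta : \int[cp]_x expR (dot eta x) =
  expR (dot eta x0 + lam%:num * (\int[r]_y expR (dot eta y) - 1)).
Proof.
have h1 := cvg_compound_poisson (x0:=x0) (lam:=lam) er (exp_type_expdot eta).
apply: (cvg_unique _ h1) => //; rewrite expRD.
set q := \int[r]_y _; have := @cvg_poisson_weight _ lam q.
move=> /(@cvgMl_tmp _ _ _ _ _ (expR (dot eta x0))).
set A := (A in A @ _ --> _ -> _); set A' := (A in _ -> A @ _ --> _).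
suff -> : A = A' by [].
apply/funext => n; rewrite /A /A' /series/= mulr_sumr; apply: eq_bigr => i _.
by rewrite jump_law_mgf mulrCA.
Qed.

(** The characteristic function of [r]. *)
Let cf xi : R[i] := Complex (\int[r]_y cos (dot xi y)) (\int[r]_y sin (dot xi y)).

Let ecos xi : exp_type (fun x : V => cos (dot xi x)).
Proof. by apply: exp_type_cos; have [] := exp_type_dot xi. Qed.

Let esin xi : exp_type (fun x : V => sin (dot xi x)).
Proof. by apply: exp_type_sin; have [] := exp_type_dot xi. Qed.

Lemma jump_law_cf xi n :
  Complex (\int[jump n]_x cos (dot xi x)) (\int[jump n]_x sin (dot xi x)) =
  Complex (cos (dot xi x0)) (sin (dot xi x0)) * cf xi ^+ n.
Proof.
elim: n => [|n ih] /=.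
  rewrite expr0 mulr1 !Rintegral_dirac//; [by have [] := esin xi|by have [] := ecos xi].
have ej := exp_moments_jump_law x0 er n.
have ir f : exp_type f -> r.-integrable setT (EFin \o f).
  by move=> ef; exact: exp_type_integrable er ef.
have ij f : exp_type f -> (jump n).-integrable setT (EFin \o f).
  by move=> ef; exact: exp_type_integrable ej ef.
rewrite exprSr mulrA -ih !integral_law_add//.
pose c := \int[r]_y cos (dot xi y); pose s := \int[r]_y sin (dot xi y).
apply/eqP; rewrite eq_complex /= -/c -/s; apply/andP; split; apply/eqP.
- transitivity (\int[jump n]_x (cos (dot xi x) * c - sin (dot xi x) * s)).
    apply: eq_Rintegral => x _.
    under eq_Rintegral do rewrite dotDr cosD.
    rewrite RintegralB//; [|exact: ir (exp_typeZ _ (ecos xi))|exact: ir (exp_typeZ _ (esin xi))].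
    by rewrite !RintegralZl//; [exact: ir (esin xi)|exact: ir (ecos xi)].
  rewrite RintegralB//; [|exact: ij (exp_typeM (ecos xi) (exp_type_cst c))|
    exact: ij (exp_typeM (esin xi) (exp_type_cst s))].
  by rewrite !RintegralZr//; [exact: ij (esin xi)|exact: ij (ecos xi)].
- transitivity (\int[jump n]_x (sin (dot xi x) * c + cos (dot xi x) * s)).
    apply: eq_Rintegral => x _.
    under eq_Rintegral do rewrite dotDr sinD.
    rewrite RintegralD//; [|exact: ir (exp_typeZ _ (ecos xi))|exact: ir (exp_typeZ _ (esin xi))].
    by rewrite !RintegralZl//; [exact: ir (esin xi)|exact: ir (ecos xi)].
  rewrite RintegralD//; [|exact: ij (exp_typeM (esin xi) (exp_type_cst c))|
    exact: ij (exp_typeM (ecos xi) (exp_type_cst s))].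
  rewrite !RintegralZr//; [|exact: ij (ecos xi)|exact: ij (esin xi)].
  by rewrite addrC.
Qed.

(** The linear combinations of the real and imaginary parts of the
    Poisson mixture of the powers of [cf xi]. *)
Let cvg_cf xi (A B : R) :
  let c := \int[r]_y cos (dot xi y) in let s := \int[r]_y sin (dot xi y) in
  series (fun n => poisson_weight lam n *
    (A * complex.Re (cf xi ^+ n) + B * complex.Im (cf xi ^+ n))) @ \oo -->
  expR (lam%:num * (c - 1)) * (A * cos (lam%:num * s) + B * sin (lam%:num * s)).
Proof.
move=> c s.
have hr := @cvg_series_Re_cexp _ (cf xi) lam%:num.
have hi := @cvg_series_Im_cexp _ (cf xi) lam%:num.
rewrite /= -/c -/s in hr hi.
set ure := series _ in hr; set uim := series _ in hi.
have : (fun n => expR (- lam%:num) * (A * ure n + B * uim n)) @ \oo -->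
  expR (- lam%:num) * (A * (expR (c * lam%:num) * cos (s * lam%:num)) +
                       B * (expR (c * lam%:num) * sin (s * lam%:num))).
  by apply: cvgMl_tmp; apply: cvgD; exact: cvgMl_tmp.
rewrite (_ : expR (- lam%:num) * _ = expR (lam%:num * (c - 1)) *
  (A * cos (lam%:num * s) + B * sin (lam%:num * s))); last first.
  rewrite mulrBr mulr1 [lam%:num * c]mulrC [lam%:num * s]mulrC expRD.
  by ring.
move=> h; apply: (cvgn_ext h) => n.
rewrite /ure /uim /series/= !mulr_sumr -big_split/= mulr_sumr; apply: eq_bigr => i _.
by rewrite /poisson_weight; ring.
Qed.

(** The real part of the characteristic function
    [exp(i xi.x0 + lam (cf xi - 1))] of a compound Poisson law. *)
Lemma compound_poisson_cos xi : \int[cp]_x cos (dot xi x) =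
  expR (lam%:num * (\int[r]_y cos (dot xi y) - 1)) *
  cos (dot xi x0 + lam%:num * \int[r]_y sin (dot xi y)).
Proof.
have h1 := cvg_compound_poisson (x0:=x0) (lam:=lam) er (ecos xi).
apply: (cvg_unique _ h1) => //.
have := @cvg_cf xi (cos (dot xi x0)) (- sin (dot xi x0)).
rewrite /= mulNr -cosD => h.
apply: (cvgn_ext h) => n.
apply: eq_bigr => i _; congr (_ * _).
by have /(congr1 (@complex.Re R)) := jump_law_cf xi i; rewrite complex_ReM/= mulNr => <-.
Qed.

(** The imaginary part of the same characteristic function. *)
Lemma compound_poisson_sin xi : \int[cp]_x sin (dot xi x) =
  expR (lam%:num * (\int[r]_y cos (dot xi y) - 1)) *
  sin (dot xi x0 + lam%:num * \int[r]_y sin (dot xi y)).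
Proof.
have h1 := cvg_compound_poisson (x0:=x0) (lam:=lam) er (esin xi).
apply: (cvg_unique _ h1) => //.
have := @cvg_cf xi (sin (dot xi x0)) (cos (dot xi x0)).
rewrite /= -sinD => h.
apply: (cvgn_ext h) => n.
apply: eq_bigr => i _; congr (_ * _).
by have /(congr1 (@complex.Im R)) := jump_law_cf xi i; rewrite complex_ImM/= addrC => <-.
Qed.

End compound_poisson_transforms.

(** * Means of Gaussian functions *)

Section gaussian_as_limit.
Context {R : realType}.
Implicit Types (u h x : R).

(** A bound of the mean value theorem, from 0 to [h]. *)
Lemma derivative_bound (f df : R -> R) (A h : R) : 0 <= h -> f 0 = 0 ->
  (forall x, is_derive x (1 : R) f (df x)) ->
  (forall x, 0 <= x <= h -> `|df x| <= A) -> `|f h| <= A * h.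
Proof.
move=> h0 f0 dfx dfA; have [h_gt0|] := ltP 0 h; last first.
  by move=> hle; rewrite (_ : h = 0) ?f0 ?normr0 ?mulr0//; apply/le_anti/andP.
have cf : {within `[0, h], continuous f}.
  by apply: derivable_within_continuous => x _; have [] := dfx x.
have [c + E] := MVT h_gt0 (fun x _ => dfx x) cf.
rewrite in_itv/= => /andP[c0 ch]; move: E; rewrite f0 !subr0 => ->.
by rewrite normrM (ger0_norm h0) ler_wpM2r// dfA// !ltW.
Qed.

Lemma cos_quadratic h : 0 <= h -> `|cos h - (1 - h ^+ 2 / 2)| <= h ^+ 3.
Proof.
move=> h0.
have c1 x : 0 <= x -> `|1 - cos x| <= x.
  move=> x0; rewrite -[leRHS]mul1r.
  apply: (@derivative_bound (fun y => 1 - cos y) (fun y => sin y)) => //.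
  - by rewrite cos0 subrr.
  - move=> y; refine (is_derive_conv (is_derive_add (is_derive_const 1 y)
      (is_derive_opp (is_derive_cos y))) _); by rewrite opprK add0r.
  - by move=> y _; rewrite ler_norml sin_geN1 sin_le1.
have c2 x : 0 <= x -> `|x - sin x| <= x * x.
  move=> x0.
  apply: (@derivative_bound (fun y => y - sin y) (fun y => 1 - cos y)) => //.
  - by rewrite sin0 subrr.
  - by move=> y /andP[y0 yx]; rewrite (le_trans (c1 _ y0)).
rewrite [h ^+ 3](_ : _ = h * h * h); last by ring.
apply: (@derivative_bound (fun y => cos y - (1 - y ^+ 2 / 2)) (fun y => y - sin y)) => //.
- by rewrite cos0 expr0n/= mul0r !subr0 subrr.
- move=> y.
  have dy2 : is_derive y (1 : R) (fun y => y ^+ 2 / 2) y.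
    rewrite (_ : (fun y => _) = (fun y => y * (2^-1 * y))).
      apply: (is_derive_conv (is_derive_mul (is_derive_ident y) (is_derive_mulM 2^-1 y))).
      by rewrite /=; lra.
    by apply/funext => x; rewrite expr2; ring.
  refine (is_derive_conv (is_derive_add (is_derive_cos y) (is_derive_opp
    (is_derive_add (is_derive_const 1 y) (is_derive_opp dy2)))) _).
  by rewrite add0r opprK addrC.
- by move=> y /andP[y0 yh]; rewrite (le_trans (c2 y y0))// ler_pM.
Qed.

Lemma expRN_linear (v : R) : 0 <= v -> `|expR (- v) - (1 - v)| <= v ^+ 2.
Proof.
move=> v0; have h1 : 1 - v <= expR (- v) by rewrite expR_ge1Dx.
rewrite ger0_norm ?subr_ge0// lerBlDr expRN.
have h2 : 1 + v <= expR v by rewrite expR_ge1Dx.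
have v1 : 0 < 1 + v by rewrite ltr_wpDr.
apply: (@le_trans _ _ (1 + v)^-1); first by rewrite lef_pV2 ?posrE ?expR_gt0.
rewrite -[leLHS]mul1r ler_pdivrMr//.
rewrite (_ : _ * _ = 1 + v ^+ 3); last by ring.
by rewrite lerDl exprn_ge0.
Qed.

Lemma exprB_bound (a b : R) n : `|a| <= 1 -> `|b| <= 1 ->
  `|a ^+ n - b ^+ n| <= n%:R * `|a - b|.
Proof.
move=> a1 b1; elim: n => [|n ih]; first by rewrite !expr0 subrr normr0 mul0r.
rewrite !exprS (_ : _ - _ = a * (a ^+ n - b ^+ n) + (a - b) * b ^+ n); last by ring.
rewrite (le_trans (ler_normD _ _))// !normrM -natr1 mulrDl mul1r.
apply: lerD.
  rewrite (le_trans _ ih)// -[leRHS]mul1r; exact: ler_wpM2r.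
by rewrite -[leRHS]mulr1 ler_wpM2l// normrX exprn_ile1.
Qed.

(** Central limit theorem for a symmetric sign, in terms of characteristic
    functions. *)
Lemma cvg_cosX u :
  (fun k => cos (u / k.+1%:R) ^+ (k.+1 ^ 2)%N) @ \oo --> expR (- (u ^+ 2 / 2)).
Proof.
wlog u0 : u / 0 <= u => [hw|].
  have [/hw//|/ltW u0] := leP 0 u.
  have := hw (- u); rewrite oppr_ge0 sqrrN => /(_ u0) /cvgn_ext; apply => k.
  by rewrite mulNr cosN.
pose A := u ^+ 3 + u ^+ 4.
have A0 : 0 <= A by rewrite addr_ge0// exprn_ge0.
have B k : `|cos (u / k.+1%:R) ^+ (k.+1 ^ 2)%N - expR (- (u ^+ 2 / 2))| <=
    A * k.+1%:R^-1.
  pose q : R := k.+1%:R; have q0 : 0 < q by rewrite ltr0n.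
  have q1 : 1 <= q by rewrite ler1n.
  pose h := u / q; have h0 : 0 <= h by rewrite divr_ge0// ltW.
  have -> : expR (- (u ^+ 2 / 2)) = expR (- (h ^+ 2 / 2)) ^+ (k.+1 ^ 2)%N.
    rewrite -expRM_natl; congr expR; rewrite natrX -/q /h; field.
    by rewrite gt_eqF.
  have v0 : 0 <= h ^+ 2 / 2 by rewrite divr_ge0// exprn_ge0.
  apply: (le_trans (exprB_bound _ _ _)).
  - by rewrite ler_norml cos_geN1 cos_le1.
  - by rewrite ger0_norm ?expR_ge0// expR_le1 oppr_le0.
  have hb : `|cos h - expR (- (h ^+ 2 / 2))| <= h ^+ 3 + h ^+ 4.
    have -> : cos h - expR (- (h ^+ 2 / 2)) = (cos h - (1 - h ^+ 2 / 2)) -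
      (expR (- (h ^+ 2 / 2)) - (1 - h ^+ 2 / 2)) by ring.
    apply: (le_trans (ler_normB _ _)); apply: lerD; first exact: cos_quadratic.
    apply: (le_trans (expRN_linear v0)).
    have := exprn_ge0 4 h0; rewrite (_ : (h ^+ 2 / 2) ^+ 2 = h ^+ 4 / 4); last by field.
    by lra.
  rewrite -/q natrX -/q -/h; apply: (le_trans (ler_wpM2l _ hb)).
    by rewrite exprn_ge0// ltW.
  rewrite /A (_ : q ^+ 2 * (h ^+ 3 + h ^+ 4) = u ^+ 3 * q^-1 + u ^+ 4 * (q^-1 * q^-1)); last first.
    by rewrite /h; field; rewrite gt_eqF.
  rewrite mulrDl lerD2l; apply: ler_wpM2l; first exact: exprn_ge0.
  by rewrite -[leRHS]mulr1 ler_wpM2l ?invr_ge0 ?(ltW q0)// invf_le1.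
apply: cvgn_dist B _.
by rewrite -[0](mulr0 A); apply: cvgMl_tmp; exact: cvg_harmonic.
Qed.

End gaussian_as_limit.

Section levy_law.
Local Open Scope complex_scope.
Context {R : realType} {d : nat}.
Local Notation V := 'rV[R]_d.
Local Notation BV := (borel_rV R d).

Lemma cexp_i (u : R) : cexp ('i * u%:C) = Complex (cos u) (sin u).
Proof.
by rewrite /cexp /= !(mul0r, mul1r, mulr0, subr0, subrr, addr0, add0r) oppr0 expR0 mul1r.
Qed.

Lemma fourierE (nu : probability BV R) (xi : V) : fourier nu xi =
  Complex (\int[nu]_x cos (dot xi x)) (\int[nu]_x sin (dot xi x)).
Proof.
by rewrite /fourier /Cintegral; congr (Complex _ _);
  apply: eq_Rintegral => x _; rewrite cexp_i.
Qed.

Lemma dot_map_complex (xi x : V) :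
  dot (map_mx (real_complex R) xi) (map_mx (real_complex R) x) = (dot xi x)%:C.
Proof.
by rewrite /dot rmorph_sum; apply: eq_bigr => i _; rewrite !mxE rmorphM.
Qed.

Lemma psi_jumpC_imag (a : V) (z : R) (r : probability BV R) (xi : V) :
  exp_moments r ->
  psi_jumpC a z r (- 'i *: map_mx (real_complex R) xi) =
  Complex (z * (\int[r]_x cos (dot xi x) - 1))
          (dot xi a - z * \int[r]_x sin (dot xi x)).
Proof.
move=> er.
have ir f : exp_type f -> r.-integrable setT (EFin \o f).
  by move=> ef; exact: exp_type_integrable er ef.
have [md _] := exp_type_dot xi.
rewrite /psi_jumpC dotC dotZl dot_map_complex.
rewrite (_ : Cintegral r setT _ =
    Complex (\int[r]_x cos (dot xi x) - 1) (- \int[r]_x sin (dot xi x))).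
  by rewrite mulNr opprK; apply/eqP; rewrite eq_complex /=; apply/andP; split;
    apply/eqP; ring.
rewrite /Cintegral; congr (Complex _ _).
  transitivity (\int[r]_x (cos (dot xi x) - 1)).
    apply: eq_Rintegral => x _; rewrite dotZl dot_map_complex.
    by rewrite mulNr -mulrN -rmorphN cexp_i/= cosN.
  rewrite RintegralB//; [|exact: ir (exp_type_cos md)|exact: ir (exp_type_cst 1)].
  rewrite Rintegral_cst// mul1r; congr (_ - _).
  transitivity (fine (1%E : \bar R)) => //; congr fine; exact: probability_setT.
transitivity (\int[r]_x (- 1 * sin (dot xi x))).
  apply: eq_Rintegral => x _; rewrite dotZl dot_map_complex.
  by rewrite mulN1r mulNr -mulrN -rmorphN cexp_i/= sinN subr0.
by rewrite RintegralZl// ?mulN1r//; exact: ir (exp_type_sin md).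
Qed.

Variables (a : V) (z t : R) (r nu : probability BV R) (lam : {nonneg R}).
Hypotheses (er : exp_moments r) (lamE : lam%:num = t * z).
Hypothesis nuE : forall xi, fourier nu xi =
  cexp (t%:C * psi_jumpC a z r (- 'i *: map_mx (real_complex R) xi)).

(** The law of the opposite of a random vector with law [nu]. *)
Local Notation P := (compound_poisson (- (t *: a)) lam r).

(** [nu] and the reflection of [P] have the same characteristic function. *)
Lemma fourier_levy xi :
  \int[nu]_x cos (dot xi x) = \int[P]_x cos (dot xi x) /\
  \int[nu]_x sin (dot xi x) = - \int[P]_x sin (dot xi x).
Proof.
have := nuE xi; rewrite fourierE psi_jumpC_imag// /cexp.
rewrite compound_poisson_cos// compound_poisson_sin// lamE.
set c := \int[r]_x cos _; set s := \int[r]_x sin _.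
rewrite dotNr dotC dotZl [dot a xi]dotC.
set th := dot xi a.
move=> /eqP; rewrite eq_complex/= => /andP[/eqP-> /eqP->].
rewrite !mul0r !addr0 !subr0.
rewrite (_ : - (t * th) + t * z * s = - (t * (th - z * s))); last by ring.
by rewrite cosN sinN mulrN opprK mulrA.
Qed.

End levy_law.

Section dominated_real.
Context {R : realType} {dT} {T : measurableType dT}.
Variables (mu : {measure set T -> \bar R}) (D : set T).
Hypothesis mD : measurable D.

(** Dominated convergence for real-valued integrals. *)
Lemma dominated_cvg_Rintegral (u : nat -> T -> R) (f g : T -> R) :
  (forall n, measurable_fun D (u n)) ->
  (forall x, D x -> u ^~ x @ \oo --> f x) ->
  mu.-integrable D (EFin \o g) ->
  (forall n x, D x -> `|u n x| <= g x) ->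
  mu.-integrable D (EFin \o f) /\
  (fun n => \int[mu]_(x in D) u n x) @ \oo --> \int[mu]_(x in D) f x.
Proof.
move=> mu_ uf ig ug.
have mf : measurable_fun D f by exact: measurable_fun_cvg uf.
have [||||iF _ cF] := @dominated_convergence _ T R mu D mD
  (fun n => EFin \o u n) (EFin \o f) (EFin \o g) _ _ _ ig _.
- by move=> n; exact/measurable_EFinP.
- exact/measurable_EFinP.
- by apply: aeW => x Dx; apply: cvg_EFin; [exact: nearW|exact: uf].
- by apply: aeW => x n Dx; rewrite lee_fin; exact: ug.
split=> //; apply: fine_cvg; rewrite fineK//.
exact: integrable_fin_num.
Qed.

End dominated_real.

Section trigonometric_functions.
Context {R : realType} {d : nat}.
Local Notation V := 'rV[R]_d.
Local Notation BV := (borel_rV R d).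
Variables (nu P : probability BV R).
Hypothesis fourier_opp : forall xi : V,
  \int[nu]_x cos (dot xi x) = \int[P]_x cos (dot xi x) /\
  \int[nu]_x sin (dot xi x) = - \int[P]_x sin (dot xi x).

Lemma measurable_opp_rV (f : V -> R) : measurable_fun setT (f : BV -> R) ->
  measurable_fun setT (fun x : BV => f (- (x : V))).
Proof.
move=> mf; have mo : measurable_fun setT (fun y : BV => - (y : V) : BV).
  apply: measurable_fun_rV => i; under eq_fun do rewrite mxE.
  by apply: measurableT_comp => //; exact: measurable_coord.
exact: measurableT_comp mf mo.
Qed.

(** [f] is bounded by 1 and its product with any cosine wave has the same mean
    under [nu] as under the reflection of [P]. *)
Definition same_mean (f : V -> R) : Prop :=
  [/\ measurable_fun setT (f : BV -> R), forall x, `|f x| <= 1 &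
   forall xi b, \int[nu]_x (cos (dot xi x + b) * f x) =
                \int[P]_x (cos (b - dot xi x) * f (- (x : V)))].

Let bounded_int (Q : probability BV R) (f : V -> R) C :
  measurable_fun setT (f : BV -> R) -> (forall x, `|f x| <= C) ->
  Q.-integrable setT (EFin \o f).
Proof.
move=> mf fC; apply: measurable_bounded_integrable => //.
  by apply: le_lt_trans (probability_le1 Q measurableT) _; rewrite ltry.
exists `|C|; split=> // M CM x _.
exact: le_trans (fC x) (le_trans (ler_norm C) (ltW CM)).
Qed.

Let mcos (f : V -> R) : measurable_fun setT (f : BV -> R) ->
  measurable_fun setT (fun x : BV => cos (f x)).
Proof. by move=> /exp_type_cos[]. Qed.

Let mwave (xi : V) (b : R) : measurable_fun setT (fun x : BV => dot xi x + b).
Proof. by apply: measurable_funD => //; have [] := exp_type_dot xi. Qed.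

Let mwaveN (xi : V) (b : R) : measurable_fun setT (fun x : BV => b - dot xi x).
Proof. by apply: measurable_funB => //; have [] := exp_type_dot xi. Qed.

Let normr_cos (x : R) : `|cos x| <= 1.
Proof. by rewrite ler_norml cos_geN1 cos_le1. Qed.

Let normr_cosM (x y : R) : `|y| <= 1 -> `|cos x * y| <= 1.
Proof. by move=> y1; rewrite normrM mulr_ile1. Qed.

Lemma same_mean1 : same_mean (fun=> 1).
Proof.
split=> [||xi b]; [by []|by rewrite normr1|].
have [hc hs] := fourier_opp xi.
have ic (Q : probability BV R) := bounded_int Q (C := 1) (mcos (exp_type_dot xi).1)
  (fun x => normr_cos _).
have is_ (Q : probability BV R) : Q.-integrable setT (EFin \o (fun x : V => sin (dot xi x))).
  apply: (bounded_int Q (C := 1)); first by have [] := exp_type_sin (exp_type_dot xi).1.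
  by move=> x; rewrite ler_norml sin_geN1 sin_le1.
transitivity (cos b * \int[nu]_x cos (dot xi x) - sin b * \int[nu]_x sin (dot xi x)).
  rewrite -!RintegralZl//; [|exact: is_|exact: ic].
  rewrite -RintegralB//; first last.
  - exact: (integrableZl measurableT (sin b) (is_ nu)).
  - exact: (integrableZl measurableT (cos b) (ic nu)).
  by apply: eq_Rintegral => x _; rewrite mulr1 cosD mulrC [sin b * _]mulrC.
rewrite hc hs mulrN opprK -!RintegralZl//; [|exact: is_|exact: ic].
rewrite -RintegralD//; first last.
- exact: (integrableZl measurableT (sin b) (is_ P)).
- exact: (integrableZl measurableT (cos b) (ic P)).
by apply: eq_Rintegral => x _; rewrite mulr1 cosB.
Qed.

(** The product of two cosines is half the sum of two cosines. *)
Lemma same_mean_cosM (f : V -> R) zeta e : same_mean f ->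
  same_mean (fun x => cos (dot zeta x + e) * f x).
Proof.
move=> [mf f1 fE]; split=> [|x|xi b].
- by apply: measurable_funM => //; exact: mcos.
- exact: normr_cosM.
have mfN := measurable_opp_rV mf.
have inu x1 b1 : nu.-integrable setT (EFin \o (fun x : V => cos (dot x1 x + b1) * f x)).
  apply: (bounded_int nu (C := 1)) => [|x]; last exact: normr_cosM.
  by apply: measurable_funM => //; exact: mcos.
have iP x1 b1 : P.-integrable setT
    (EFin \o (fun x : V => cos (b1 - dot x1 x) * f (- x))).
  apply: (bounded_int P (C := 1)) => [|x]; last exact: normr_cosM.
  by apply: measurable_funM => //; exact: mcos.
transitivity (2^-1 * \int[nu]_x (cos (dot (xi + zeta) x + (b + e)) * f x) +
              2^-1 * \int[nu]_x (cos (dot (xi - zeta) x + (b - e)) * f x)).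
  rewrite -!RintegralZl//; do ?exact: inu.
  rewrite -RintegralD//; first last.
  - exact: (integrableZl measurableT 2^-1 (inu _ _)).
  - exact: (integrableZl measurableT 2^-1 (inu _ _)).
  apply: eq_Rintegral => x _.
  rewrite !dotDl dotNl (_ : _ + _ + (b + e) = (dot xi x + b) + (dot zeta x + e)); last by ring.
  rewrite (_ : _ - _ + (b - e) = (dot xi x + b) - (dot zeta x + e)); last by ring.
  by move: (dot xi x + b) (dot zeta x + e) => A B; rewrite cosD cosB; field.
rewrite !fE -!RintegralZl//; do ?exact: iP.
rewrite -RintegralD//; first last.
- exact: (integrableZl measurableT 2^-1 (iP _ _)).
- exact: (integrableZl measurableT 2^-1 (iP _ _)).
apply: eq_Rintegral => x _.
rewrite !dotDl dotNl dotNr (_ : b + e - _ = (b - dot xi x) + (- dot zeta x + e)); last by ring.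
rewrite (_ : b - e - _ = (b - dot xi x) - (- dot zeta x + e)); last by ring.
by move: (b - dot xi x) (- dot zeta x + e) => A B; rewrite cosD cosB; field.
Qed.

Lemma same_mean_cosX (f : V -> R) zeta e n : same_mean f ->
  same_mean (fun x => cos (dot zeta x + e) ^+ n * f x).
Proof.
move=> fP; elim: n => [|n ih]; first by under eq_fun do rewrite expr0 mul1r.
by under eq_fun do rewrite exprS -mulrA; exact: same_mean_cosM.
Qed.

Lemma same_mean_prod (I : Type) (s : seq I) (zeta : I -> V) (e : I -> R) n :
  same_mean (fun x => \prod_(i <- s) cos (dot (zeta i) x + e i) ^+ n).
Proof.
elim: s => [|i s ih]; first by under eq_fun do rewrite big_nil; exact: same_mean1.
by under eq_fun do rewrite big_cons; exact: same_mean_cosX.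
Qed.

Lemma same_meanE (f : V -> R) : same_mean f ->
  \int[nu]_x f x = \int[P]_x f (- (x : V)).
Proof.
move=> [_ _ /(_ 0 0)].
under eq_Rintegral do rewrite dot0l addr0 cos0 mul1r.
by under [X in _ = X]eq_Rintegral do rewrite dot0l subr0 cos0 mul1r.
Qed.

(** Gaussian functions are bounded pointwise limits of products of cosines. *)
Lemma gaussian_mean (b : R) (phi : V) : 0 <= b ->
  nu.-integrable setT
    (EFin \o (fun x : V => expR (- (b * dot (phi - x) (phi - x))))) /\
  \int[nu]_x expR (- (b * dot (phi - (x : V)) (phi - (x : V)))) =
  \int[P]_x expR (- (b * dot (phi + (x : V)) (phi + (x : V)))).
Proof.
(* [c] is such that the limit [exp(- u^2 / 2)] at [u = c y] is [exp(- b y^2)]. *)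
move=> b0; pose c := Num.sqrt (2 * b).
have c2 : c ^+ 2 = 2 * b by rewrite sqr_sqrtr// mulr_ge0.
pose zeta (k : nat) (i : 'I_d) : V := - (c / k.+1%:R) *: delta_mx 0 i.
pose e (k : nat) (i : 'I_d) : R := c * phi 0 i / k.+1%:R.
pose u (k : nat) (x : V) : R :=
  \prod_(i < d) cos (dot (zeta k i) x + e k i) ^+ (k.+1 ^ 2)%N.
have dotz k i x : dot (zeta k i) x + e k i = (c * (phi - x) 0 i) / k.+1%:R.
  rewrite /zeta /e dotZl (_ : dot (delta_mx 0 i) x = x 0 i).
    by rewrite !mxE; ring.
  rewrite /dot (bigD1 i)//= big1 ?mxE ?eqxx ?mul1r ?addr0// => j ji.
  by rewrite mxE (negPf ji) andbF mul0r.
pose g (x : V) := expR (- (b * dot (phi - x) (phi - x))).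
have uP k : same_mean (u k) by exact: same_mean_prod.
have ug x : u ^~ x @ \oo --> g x.
  rewrite /g (_ : expR _ = \prod_(i < d) expR (- ((c * (phi - x) 0 i) ^+ 2 / 2))).
    apply: cvgn_prod => i. apply: (cvgn_ext (@cvg_cosX _ (c * (phi - x) 0 i))) => k.
    by rewrite dotz.
  rewrite -expR_sum /dot mulr_sumr -sumrN; congr expR; apply: eq_bigr => i _.
  by rewrite exprMn c2; field.
have cst1 (Q : probability BV R) : Q.-integrable setT (EFin \o (fun x : V => 1)).
  by apply: (bounded_int Q (C := 1)) => // x; rewrite normr1.
have [ig hnu] : nu.-integrable setT (EFin \o g) /\
    (fun n => \int[nu]_x u n x) @ \oo --> \int[nu]_x g x.
  apply: (dominated_cvg_Rintegral measurableT _ _ (cst1 nu)) => //.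
  - by move=> k; have [] := uP k.
  - by move=> k x _; have [_ + _] := uP k; apply.
have [_ hP] : P.-integrable setT (EFin \o (fun x : V => g (- x))) /\
    (fun n => \int[P]_x u n (- (x : V))) @ \oo --> \int[P]_x g (- (x : V)).
  apply: (dominated_cvg_Rintegral measurableT _ _ (cst1 P)) => //.
  - by move=> k; apply: measurable_opp_rV; have [] := uP k.
  - by move=> k x _; have [_ + _] := uP k; apply.
split; first exact: ig.
transitivity (\int[P]_x g (- (x : V))).
  apply: (cvg_unique _ hnu) => //; apply: (cvgn_ext hP) => k.
  exact: same_meanE.
by apply: eq_Rintegral => x _; rewrite /g opprK.
Qed.

End trigonometric_functions.

(** * Moments and cumulants *)

Section differentiation.
Context {R : realType} {d : nat}.
Local Notation V := 'rV[R]_d.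
Local Notation BV := (borel_rV R d).
Implicit Types (eta : V).

Lemma exp_type_norm (f : V -> R) : exp_type f -> exp_type (fun x => `|f x|).
Proof.
move=> [mf [C [s [C0 s0 fC]]]]; split; first exact: measurableT_comp.
by exists C, s; split=> // x; rewrite normr_id.
Qed.

Lemma dot_delta (x : V) k : dot (delta_mx 0 k) x = x 0 k.
Proof.
rewrite /dot (bigD1 k)//= big1 ?mxE ?eqxx ?mul1r ?addr0// => j jk.
by rewrite mxE (negPf jk) andbF mul0r.
Qed.

(** Differentiation of a Laplace transform under the integral sign. *)
Lemma is_derive_laplace (mu : {measure set BV -> \bar R}) (p : V -> R) eta k :
  exp_moments mu -> exp_type p ->
  is_derive eta (delta_mx 0 k : V) (fun y : V => \int[mu]_x (p x * expR (dot y x)))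
    (\int[mu]_x (p x * x 0 k * expR (dot eta x))).
Proof.
move=> emu ep.
pose f (h : R) (x : BV) : R := p x * expR (dot eta x + h * (x : V) 0 k).
have ef h : exp_type (f h).
  rewrite /f; under eq_fun do rewrite expRD; apply: exp_typeM => //.
  apply: exp_typeM; first exact: exp_type_expdot.
  rewrite (_ : (fun x => _) = (fun x : V => expR (dot (h *: delta_mx 0 k) x))).
    exact: exp_type_expdot.
  by apply/funext => x; rewrite dotZl dot_delta.
have df h (x : BV) : is_derive h (1 : R) (f ^~ x)
    (p x * (x : V) 0 k * expR (dot eta x + h * (x : V) 0 k)).
  have d1 : is_derive h (1 : R) (fun h : R => dot eta x + (x : V) 0 k * h) ((x : V) 0 k).
    by refine (is_derive_conv (is_derive_add (is_derive_const _ _) (is_derive_mulM _ _)) _);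
      rewrite add0r.
  have d2 := @is_derive1_comp R expR (fun h : R => dot eta x + (x : V) 0 k * h) h _ _
    (is_derive_expR _) d1.
  have d3 := is_derive_mul (is_derive_const (p x) h) d2.
  rewrite mul0r add0r in d3.
  rewrite (_ : f ^~ x = fun y => p x * (expR \o (fun h : R => dot eta x + (x : V) 0 k * h)) y).
    by refine (is_derive_conv d3 _); rewrite /= [h * _]mulrC; ring.
  by apply/funext => y; rewrite /f /= [y * _]mulrC.
have dfE h (x : BV) : partial1of2 f h x =
    p x * (x : V) 0 k * expR (dot eta x + h * (x : V) 0 k).
  by rewrite partial1of2E; have [] := df h x.
pose G (x : BV) : R := `|p x * (x : V) 0 k| * (expR (dot eta x) * expR (1 * `|x : V|)).
have eG : exp_type G.
  apply: exp_typeM; first by apply/exp_type_norm/exp_typeM => //; exact: exp_type_coord.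
  by apply: exp_typeM; [exact: exp_type_expdot|exact: exp_type_expnorm].
have I0 : [set` `]-1, 1[%R] (0 : R) by rewrite /= in_itv/= ltrN10 ltr01.
have fint h : [set` `](-1 : R), 1[%R] h -> mu.-integrable setT (EFin \o f h).
  by move=> _; exact: exp_type_integrable emu (ef h).
have fder h (x : BV) : [set` `](-1 : R), 1[%R] h -> setT x -> derivable (f ^~ x) h 1.
  by move=> _ _; have [] := df h x.
have fG h (x : BV) : [set` `](-1 : R), 1[%R] h -> setT x -> `|partial1of2 f h x| <= G x.
  rewrite /= in_itv/= => /andP[h1 h2] _; rewrite dfE normrM; apply: ler_wpM2l => //.
  rewrite ger0_norm ?expR_ge0// -expRD ler_expR lerD2l mul1r.
  apply: (le_trans (ler_norm _)); rewrite normrM -[leRHS]mul1r.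
  apply: ler_pM => //; last exact: normr_coord.
  by rewrite ler_norml !ltW.
have G0 (x : BV) : 0 <= G x by rewrite mulr_ge0// mulr_ge0// expR_ge0.
have := cvg_differentiation_under_integral measurableT I0 fint fder G0
  (exp_type_integrable emu eG) fG.
rewrite (_ : \int[mu]_y partial1of2 f 0 y = \int[mu]_x (p x * x 0 k * expR (dot eta x))); last first.
  by apply: eq_Rintegral => x _; rewrite dfE mul0r addr0.
set A := (A in A @ _ --> _ -> _) => cvA.
have EA : (fun h => h^-1 *: (((fun y : V => \int[mu]_x (p x * expR (dot y x))) \o shift eta)
    (h *: (delta_mx 0 k : V)) - \int[mu]_x (p x * expR (dot eta x)))) = A.
  apply/funext => h; rewrite /A /=; congr (_ *: (_ - _)).
    by apply: eq_Rintegral => x _; rewrite /f addr0 addrC dotDl dotZl dot_delta.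
  by apply: eq_Rintegral => x _; rewrite /f mul0r addr0.
apply: DeriveDef; first by rewrite /derivable EA; apply/cvg_ex; eexists; exact: cvA.
by rewrite /derive EA; apply/cvg_lim.
Qed.

End differentiation.

Section directional_derivatives.
Context {R : realType} {V : normedModType R}.
Implicit Types (f g : V -> R) (x v : V).

(** A directional derivative is a derivative along a line, which reduces the
    rules below to those of one variable. *)
Lemma is_derive_line f x v (df : R) : is_derive x v f df <->
  is_derive (0 : R) (1 : R) (fun h : R => f (h *: v + x)) df.
Proof.
have E : (fun h : R => h^-1 *: ((f \o shift x) (h *: v) - f x)) =
    (fun h : R => h^-1 *: (((fun h : R => f (h *: v + x)) \o shift (0 : R)) (h *: (1 : R))
      - f ((0 : R) *: v + x))).
  apply/funext => h /=; rewrite scale0r add0r addr0.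
  by congr (_ *: (f (_ *: v + x) - _)); rewrite /GRing.scale/= mulr1.
by split=> -[df1 df2]; apply: DeriveDef;
  rewrite ?/derivable ?/derive ?E -?E// in df1 df2 *.
Qed.

Lemma is_derive_dirM f g x v df dg : is_derive x v f df -> is_derive x v g dg ->
  is_derive x v (fun y => f y * g y) (df * g x + f x * dg).
Proof.
move=> /is_derive_line fd /is_derive_line gd.
refine (proj2 (is_derive_line _ _ _ _) (is_derive_conv (is_derive_mul fd gd) _)).
by rewrite scale0r add0r.
Qed.

Lemma is_derive_dirD f g x v df dg : is_derive x v f df -> is_derive x v g dg ->
  is_derive x v (fun y => f y + g y) (df + dg).
Proof.
move=> /is_derive_line fd /is_derive_line gd.
by refine (proj2 (is_derive_line _ _ _ _) (is_derive_add fd gd)).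
Qed.

Lemma is_derive_dirC (c : R) x v : is_derive x v (fun=> c) 0.
Proof. exact: (proj2 (is_derive_line _ _ _ _) (is_derive_const c 0)). Qed.

Lemma is_derive_dirZ (c : R) f x v df : is_derive x v f df ->
  is_derive x v (fun y => c * f y) (c * df).
Proof.
move=> /is_derive_line fd.
refine (proj2 (is_derive_line _ _ _ _)
  (is_derive_conv (is_derive_mul (is_derive_const c 0) fd) _)).
by rewrite mul0r add0r.
Qed.

Lemma is_derive_dir_sum (I : Type) (s : seq I) (P : pred I) (F : I -> V -> R) dF x v :
  (forall i, P i -> is_derive x v (F i) (dF i)) ->
  is_derive x v (fun y => \sum_(i <- s | P i) F i y) (\sum_(i <- s | P i) dF i).
Proof.
move=> h; elim: s => [|i s ih].
  rewrite big_nil; under eq_fun do rewrite big_nil; exact: is_derive_dirC.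
rewrite big_cons; have [Pi|Pi] := boolP (P i).
  by under eq_fun do rewrite big_cons Pi; exact: (is_derive_dirD (h i Pi) ih).
by under eq_fun do rewrite big_cons (negPf Pi).
Qed.

Lemma is_derive_dir_expR f x v df : is_derive x v f df ->
  is_derive x v (fun y => expR (f y)) (df * expR (f x)).
Proof.
move=> /is_derive_line fd; apply: (proj2 (is_derive_line _ _ _ _)).
have := @is_derive1_comp R expR _ 0 _ _ (is_derive_expR _) fd.
by rewrite scale0r add0r mulrC.
Qed.

End directional_derivatives.

Section cumulants.
Context {R : realType} {d : nat}.
Local Notation V := 'rV[R]_d.
Local Notation BV := (borel_rV R d).
Variables (a : V) (z : R) (r : probability BV R).
Hypothesis er : exp_moments r.

Lemma is_derive_dot (k : 'I_d) (eta : V) :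
  is_derive eta (delta_mx 0 k : V) (dot a) (a 0 k).
Proof.
rewrite (_ : dot a = fun y : V => \sum_(i < d) a 0 i * y 0 i)//.
apply: (proj2 (is_derive_line _ _ _ _)).
rewrite (_ : (fun h : R => _) = fun h : R => dot a eta + a 0 k * h).
  refine (is_derive_conv (is_derive_add (is_derive_const _ _) (is_derive_mulM _ _)) _).
  by rewrite add0r.
apply/funext => h; rewrite -/(dot a _) dotDr dotC dotZl dot_delta addrC.
by rewrite mulrC.
Qed.

Let ir f : exp_type f -> r.-integrable setT (EFin \o f).
Proof. by move=> ef; exact: exp_type_integrable er ef. Qed.

(** The constant [-1] may be integrated apart, [r] being a probability. *)
Lemma psi_jumpE : psi_jump a z r =
  fun eta => - dot a eta + z * (\int[r]_x expR (dot eta x) - 1).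
Proof.
apply/funext => eta; rewrite /psi_jump; congr (_ + _ * _).
rewrite RintegralB//; [|exact: ir (exp_type_expdot eta)|exact: ir (exp_type_cst 1)].
rewrite Rintegral_cst// mul1r; congr (_ - _).
transitivity (fine (1%E : \bar R)) => //; congr fine; exact: probability_setT.
Qed.

Section indexed.
Context {E : finType}.
Variable (X : E -> 'I_d).
Implicit Types (U v : {set E}) (e : E).

(** The partial derivative of [psi_jump] in the directions [X e], [e] in [U],
    for a nonempty set [U]; the drift contributes to first derivatives only. *)
Definition cumulant U (eta : V) : R :=
  (if #|U| == 1%N then - \sum_(e in U) a 0 (X e) else 0) +
  z * \int[r]_x ((\prod_(j in U) (x : V) 0 (X j)) * expR (dot eta x)).

Lemma exp_type_monomial U : exp_type (fun x : V => \prod_(e in U) x 0 (X e)).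
Proof. by apply: exp_type_prod => e _; exact: exp_type_coord. Qed.

Lemma is_derive_monomial (mu : {measure set BV -> \bar R}) U e eta :
  exp_moments mu -> e \notin U ->
  is_derive eta (delta_mx 0 (X e) : V)
    (fun y : V => \int[mu]_x ((\prod_(j in U) (x : V) 0 (X j)) * expR (dot y x)))
    (\int[mu]_x ((\prod_(j in e |: U) (x : V) 0 (X j)) * expR (dot eta x))).
Proof.
move=> emu eU.
have <- : \int[mu]_x ((\prod_(j in U) (x : V) 0 (X j)) * (x : V) 0 (X e) * expR (dot eta x)) =
    \int[mu]_x ((\prod_(j in e |: U) (x : V) 0 (X j)) * expR (dot eta x)).
  by apply: eq_Rintegral => x _; rewrite big_setU1//= [X in X * _]mulrC.
exact: is_derive_laplace emu (exp_type_monomial U).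
Qed.

Lemma is_derive_psi_jump e eta :
  is_derive eta (delta_mx 0 (X e) : V) (psi_jump a z r) (cumulant [set e]%SET eta).
Proof.
rewrite psi_jumpE.
have dm := is_derive_monomial (U := finset.set0) eta er (negbT (finset.in_set0 e)).
rewrite finset.setU0 (_ : (fun y => _) = fun y : V => \int[r]_x expR (dot y x)) in dm; last first.
  apply/funext => y; apply: eq_Rintegral => x _; by rewrite big_set0 mul1r.
have dd := is_derive_dot (X e) eta.
have := is_derive_dirD (is_derive_dirZ (-1) dd)
  (is_derive_dirZ z (is_derive_dirD dm (is_derive_dirC (- 1) _ _))).
rewrite /cumulant cards1 eqxx big_set1 addr0 mulN1r.
rewrite (_ : (fun y => _) = fun y : V => - dot a y + z * (\int[r]_x expR (dot y x) - 1))//.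
by apply/funext => y; rewrite mulN1r.
Qed.

Lemma is_derive_cumulant U e eta : U != finset.set0 -> e \notin U ->
  is_derive eta (delta_mx 0 (X e) : V) (cumulant U) (cumulant (e |: U) eta).
Proof.
move=> U0 eU.
have -> : cumulant (e |: U) eta =
    0 + z * \int[r]_x ((\prod_(j in e |: U) (x : V) 0 (X j)) * expR (dot eta x)).
  by rewrite /cumulant ifF// cardsU1 eU eqSS cards_eq0 (negPf U0).
exact: (is_derive_dirD (is_derive_dirC _ _ _)
  (is_derive_dirZ z (is_derive_monomial eta er eU))).
Qed.

Variables (P : probability BV R) (t : R).
Hypothesis eP : exp_moments P.
Hypothesis mgfP : forall eta, \int[P]_x expR (dot eta x) = expR (t * psi_jump a z r eta).

(** The derivative of the moment generating function of [P] in the directions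
    [X e], [e] in [U]. *)
Let moment U (eta : V) := \int[P]_x ((\prod_(j in U) (x : V) 0 (X j)) * expR (dot eta x)).

Let moment_set0 : moment finset.set0 = fun eta => expR (t * psi_jump a z r eta).
Proof.
apply/funext => eta; rewrite -mgfP; apply: eq_Rintegral => x _.
by rewrite big_set0 mul1r.
Qed.

(** Leibniz' rule applied to [M_e = t psi_e M], where [M = exp(t psi)] is the
    moment generating function of [P], [psi] stands for [psi_jump] and the index
    for a derivative. *)
Let moment_rec U e eta : e \notin U ->
  moment (e |: U) eta =
  \sum_(v : {set E} | v \subset U) (t * cumulant (e |: v) eta) * moment (U :\: v) eta.
Proof.
have [n] := ubnP #|U|; elim: n U e eta => // n ih U e eta Un eU.
have [U0|[e1 e1U]] := set_0Vmem U.
  rewrite U0 (big_pred1 finset.set0); last by move=> v; rewrite /= finset.subset0.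
  have d1 := is_derive_monomial (U := finset.set0) eta eP (negbT (finset.in_set0 e)).
  rewrite -/(moment _) -/(moment _ _) in d1.
  have d2 := is_derive_dir_expR (is_derive_dirZ t (is_derive_psi_jump e eta)).
  rewrite -moment_set0 in d2.
  have := derive_val (is_derive := d1); rewrite (derive_val (is_derive := d2)).
  by rewrite finset.set0D moment_set0 finset.setU0 => ->.
pose U' := U :\ e1; have e1U' : e1 \notin U' by rewrite finset.setD11.
have eU' : e \notin U' by rewrite inE (negPf eU) andbF.
have ee1 : e1 != e by apply: contraNneq eU => <-.
have e1eU' : e1 \notin e |: U' by rewrite !inE (negPf ee1) eqxx.
have U'n : (#|U'| < n)%N by move: Un; rewrite (cardsD1 e1) e1U.
have UE : U = e1 |: U' by rewrite finset.setD1K.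
have d1 := is_derive_monomial eta eP e1eU'; rewrite -/(moment _) -/(moment _ _) in d1.
have E1 : moment (e |: U') = fun eta =>
    \sum_(v : {set E} | v \subset U') (t * cumulant (e |: v) eta) * moment (U' :\: v) eta.
  by apply/funext => y; exact: ih.
have d2 : is_derive eta (delta_mx 0 (X e1) : V) (moment (e |: U'))
    (\sum_(v : {set E} | v \subset U')
       ((t * cumulant (e1 |: (e |: v)) eta) * moment (U' :\: v) eta +
        (t * cumulant (e |: v) eta) * moment (e1 |: (U' :\: v)) eta)).
  rewrite E1; apply: is_derive_dir_sum => v vU'.
  have e1v : e1 \notin v by apply: contra e1U' => /(fintype.subsetP vU').
  apply: is_derive_dirM.
    apply: is_derive_dirZ; apply: is_derive_cumulant.
      by apply/finset.set0Pn; exists e; rewrite finset.setU11.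
    by rewrite !inE (negPf ee1).
  by apply: is_derive_monomial => //; rewrite inE (negPf e1U') andbF.
have := derive_val (is_derive := d1); rewrite (derive_val (is_derive := d2)).
rewrite UE finset.setUCA => <-.
rewrite sum_subsetU1// big_split/= addrC; congr (_ + _); apply: eq_bigr => v vU'.
  congr (_ * moment _ eta); apply/finset.setP => x; rewrite !inE.
  case: (eqVneq x e1) => //= ->.
  by rewrite andbT; apply/esym; apply: contra e1U' => /(fintype.subsetP vU').
rewrite finset.setUCA; congr (_ * moment _ eta); apply/finset.setP => x; rewrite !inE.
by case: (eqVneq x e1) => //= ->; rewrite andbF.
Qed.

(** The moments of [P] in terms of its cumulants, which are [t] times the
    derivatives of [psi_jump] at 0. *)
Lemma moment_partition U :
  \int[P]_x (\prod_(j in U) (x : V) 0 (X j)) =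
  partition_sum (fun v => t * cumulant v 0) U.
Proof.
have -> : \int[P]_x (\prod_(j in U) (x : V) 0 (X j)) = moment U 0.
  by apply: eq_Rintegral => x _; rewrite dot0l expR0 mulr1.
apply: (partition_sum_unique (M := fun U => moment U 0)).
  rewrite moment_set0 -mgfP; under eq_Rintegral do rewrite dot0l expR0.
  rewrite Rintegral_cst// mul1r.
  by transitivity (fine (1%E : \bar R)) => //; congr fine; exact: probability_setT.
by move=> e U' eU'; exact: moment_rec.
Qed.

End indexed.
End cumulants.

(** * Moments as sums over graphs *)

Section moments_as_graph_sums.
Context {R : realType} {d : nat}.
Local Notation V := 'rV[R]_d.
Local Notation BV := (borel_rV R d).
Variables (a : V) (z t : R) (r P : probability BV R) (phi : V).
Hypotheses (er : exp_moments r) (eP : exp_moments P).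
Hypothesis mgfP : forall eta, \int[P]_x expR (dot eta x) = expR (t * psi_jump a z r eta).

Lemma jump_coefE (E : finType) (X : E -> 'I_d) (v : {set E}) : v != finset.set0 ->
  jump_coef a z r [seq X e | e <- enum v] = cumulant a z r X v 0.
Proof.
move=> v0; rewrite /jump_coef.
suff h (s : seq E) : uniq s -> s != [::] ->
    foldr (fun k (f : V -> R) => 'D_(delta_mx 0 k) f) (psi_jump a z r) [seq X e | e <- s] =
    cumulant a z r X [set e in s]%SET.
  rewrite h ?enum_uniq ?finset.set_enum//.
  by apply: contra v0 => /eqP e0; rewrite -cards_eq0 cardE e0.
elim: s => // e s ih /= /andP[es us] _; apply/funext => eta.
have [->|s0] := eqVneq s [::].
  by rewrite /= finset.set_cons finset.set_nil finset.setU0;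
    have [] := @is_derive_psi_jump _ _ a z _ er _ X e eta.
rewrite ih// finset.set_cons; have := @is_derive_cumulant _ _ a z _ er _ X [set x in s]%SET e eta.
case=> //.
- case: s s0 {ih es us} => // e' s _; apply/finset.set0Pn; exists e'.
  by rewrite !inE eqxx.
- by rewrite inE.
Qed.

(** Each of the two ends of an edge carries the index of the edge. *)
Lemma dotX (y : V) m : dot y y ^+ m =
  \sum_(X : {ffun 'I_m -> 'I_d}) \prod_(e : edge_end m) y 0 (X e.1).
Proof.
rewrite /dot -[m in LHS]card_ord -prodr_const.
rewrite (bigA_distr_bigA (fun (j : 'I_m) k => y 0 k * y 0 k)); apply: eq_bigr => X _.
rewrite -(pair_big xpredT xpredT (fun (j : 'I_m) (b : bool) => y 0 (X j)))/=.
by apply: eq_bigr => j _; rewrite big_bool.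
Qed.

(** The set [S] below consists of the edge-ends that are met by outer vertices:
    in the expansion of the product of the [phi + x] over all edge-ends, these
    contribute [phi] and the others [x]. *)
Lemma moment_graphs m :
  \int[P]_x (dot (phi + x) (phi + x) ^+ m) =
  \sum_(G in Qbar m) graph_value a z r t phi G.
Proof.
have eX m' (S : {set edge_end m'}) (X : {ffun 'I_m' -> 'I_d}) :
    exp_type (fun x : V => \prod_(e in S) x 0 (X e.1)).
  by apply: exp_type_prod => e _; exact: exp_type_coord.
have iP (f : V -> R) : exp_type f -> P.-integrable setT (EFin \o f).
  by move=> ef; exact: exp_type_integrable eP ef.
pose c (X : {ffun 'I_m -> 'I_d}) (S : {set edge_end m}) := \prod_(e in S) phi 0 (X e.1).
have sumI (I : Type) (s : seq I) (f : I -> V -> R) : (forall i, exp_type (f i)) ->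
    \int[P]_x (\sum_(i <- s) f i x) = \sum_(i <- s) \int[P]_x f i x.
  move=> ef; elim: s => [|i s ih].
    under eq_Rintegral do rewrite big_nil; rewrite big_nil.
    by rewrite Rintegral_cst// mul0r.
  under eq_Rintegral do rewrite big_cons.
  rewrite RintegralD ?big_cons ?ih//; first exact: iP.
  by apply: iP; apply: exp_type_sum => j _.
transitivity (\int[P]_x (\sum_(X : {ffun 'I_m -> 'I_d}) \sum_(S : {set edge_end m})
    (c X S * \prod_(e in ~: S) (x : V) 0 (X e.1)))).
  apply: eq_Rintegral => x _; rewrite dotX; apply: eq_bigr => X _.
  under eq_bigr do rewrite mxE.
  rewrite bigA_distr; apply: eq_bigr => S _.
  rewrite (bigID (fun e => e \in S))/=; congr (_ * _).
    by apply: eq_bigr => e ->.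
  apply: eq_big => [e|e /negPf ->//]; by rewrite inE.
transitivity (\sum_(X : {ffun 'I_m -> 'I_d}) \sum_(S : {set edge_end m}) (c X S *
    partition_sum (fun v => t * cumulant a z r (fun e : edge_end m => X e.1) v 0) (~: S))).
  rewrite sumI => [|X]; last first.
    by apply: exp_type_sum => S _; apply: exp_typeZ; exact: eX.
  apply: eq_bigr => X _; rewrite sumI => [|S]; last by apply: exp_typeZ; exact: eX.
  apply: eq_bigr => S _; rewrite RintegralZl//; last exact: iP (eX _ _ _).
  congr (_ * _); exact: (moment_partition er (fun e : edge_end m => X e.1) eP mgfP).
rewrite /graph_value [RHS]exchange_big/=; apply: eq_bigr => X _.
rewrite (sum_Qbar (fun v => t * jump_coef a z r [seq X e.1 | e <- enum v])
  (fun e => phi 0 (X e.1))).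
apply: eq_bigr => S _; congr (_ * _); apply: eq_bigr => p pS.
apply: eq_bigr => v vp; rewrite (@jump_coefE _ (fun e : edge_end m => X e.1))//.
exact: partition_neq0 pS vp.
Qed.

End moments_as_graph_sums.

(** * The Bessel function of order zero and its Laplace transform *)

Section exponential_bounds.
Context {R : realType}.
Implicit Types (x y : R).

Lemma expR_ge_term x n : 0 <= x -> x ^+ n / n`!%:R <= expR x.
Proof.
move=> x0; case: n => [|n]; last first.
  by apply: le_trans (expR_ge1Dxn n x0); rewrite lerDr.
by rewrite expr0 fact0 divr1 -(expR0 R) ler_expR.
Qed.

Lemma expR_ge_series x n : 0 <= x -> \sum_(0 <= k < n) x ^+ k / k`!%:R <= expR x.
Proof.
move=> x0; apply: (@nondecreasing_cvgn_le _ (series (fun k => x ^+ k / k`!%:R))) => //.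
  by apply: nondecreasing_series => k _ _; rewrite divr_ge0// exprn_ge0.
apply/cvg_ex; exists (expR x); exact: cvg_series_expR.
Qed.

End exponential_bounds.

Section bessel.
Context {R : realType}.
Implicit Types (u x : R).

(** Coefficients of the Bessel function [J_0(2 sqrt u)], as a power series
    in [u]. *)
Definition bessel_coef (n : nat) : R := (- 1) ^+ n / (n`!%:R ^+ 2).

(** The function [J_0(2 sqrt u)]. *)
Definition bessel u : R := limn (pseries bessel_coef u).

Lemma bessel_coef_bounded : exp_bounded bessel_coef.
Proof.
exists 1, 1; split=> // n; rewrite /bessel_coef normrM normrX normrN1 expr1n !mul1r.
rewrite ger0_norm// ?invr_ge0 ?exprn_ge0// expr2 invfM -[leRHS]mul1r ler_wpM2r//.
by rewrite invf_le1 ?ltr0n ?fact_gt0// ler1n fact_gt0.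
Qed.

Let J' u : R := limn (pseries (pseries_diffs bessel_coef) u).
Let J'' u : R := limn (pseries (pseries_diffs (pseries_diffs bessel_coef)) u).

Lemma is_derive_bessel u : is_derive u (1 : R) bessel (J' u).
Proof. exact: is_derive_pseries bessel_coef_bounded. Qed.

Let dJ' u : is_derive u (1 : R) J' (J'' u).
Proof. by apply: is_derive_pseries; apply: exp_bounded_diffs; exact: bessel_coef_bounded. Qed.

(** The differential equation [u J'' + J' + J = 0]. *)
Let bessel_ode u : u * J'' u + J' u = - bessel u.
Proof.
have b0 := bessel_coef_bounded; have b1 := exp_bounded_diffs b0.
have b2 := exp_bounded_diffs b1.
have c0 := exp_bounded_cvg (x := u) b0.
have c1 := exp_bounded_cvg (x := u) b1.
have c2 := exp_bounded_cvg (x := u) b2.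
have c0' : (fun n => - pseries bessel_coef u n.+1) @ \oo --> - bessel u.
  by apply: cvgN; rewrite (cvg_shiftS (pseries bessel_coef u)).
have c1' : (fun n => pseries (pseries_diffs bessel_coef) u n.+1) @ \oo --> J' u.
  by rewrite (cvg_shiftS (pseries (pseries_diffs bessel_coef) u)).
have c2' : (fun n => u * pseries (pseries_diffs (pseries_diffs bessel_coef)) u n) @ \oo --> u * J'' u.
  by apply: cvgMl_tmp.
apply: (cvg_unique _ (cvgD c2' c1')) => //; apply: (cvgn_ext c0') => n.
rewrite fctE /pseries/= /series/= mulr_sumr big_nat_recl//= [in RHS]big_nat_recl//=.
rewrite opprD addrCA; congr (_ + _).
  by rewrite /pseries_diffs /bessel_coef !expr0 fact0 expr1 (_ : 1`! = 1%N)//; field.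
rewrite -big_split/= -sumrN; apply: eq_bigr => i _.
rewrite /pseries_diffs /bessel_coef !factS !natrM !exprS.
by field; rewrite nat1r -natrD !pnatr_eq0 -lt0n fact_gt0.
Qed.

(** [J^2 + u J'^2] is nonincreasing, because its derivative is [- J'^2]. *)
Lemma normr_bessel_le1 u : 0 <= u -> `|bessel u| <= 1.
Proof.
move=> u0; pose H y := bessel y * bessel y + y * (J' y * J' y).
have dH y : is_derive y (1 : R) H (- (J' y * J' y)).
  have dJ := is_derive_bessel y.
  refine (is_derive_conv (is_derive_add (is_derive_mul dJ dJ)
    (is_derive_mul (is_derive_ident y) (is_derive_mul (dJ' y) (dJ' y)))) _).
  have -> : bessel y = - (y * J'' y + J' y) by rewrite bessel_ode opprK.
  by ring.
have H0 : H 0 = 1.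
  by rewrite /H mul0r addr0 /bessel pseries0 /bessel_coef expr0 fact0 expr1n divr1 mulr1.
have Hu : H u <= 1.
  have [u_gt0|] := ltP 0 u; last first.
    by move=> ule; rewrite (_ : u = 0) ?H0//; apply/le_anti/andP.
  have cH : {within `[0, u], continuous H}.
    by apply: derivable_within_continuous => x _; have [] := dH x.
  have [c _ E] := MVT u_gt0 (fun x _ => dH x) cH.
  rewrite -H0 -subr_le0 E mulNr oppr_le0 mulr_ge0// ?subr0//.
  by rewrite -expr2 sqr_ge0.
have : bessel u ^+ 2 <= 1.
  rewrite (le_trans _ Hu)// /H expr2 lerDl mulr_ge0//.
  by rewrite -expr2 sqr_ge0.
by rewrite -real_normK ?num_real// expr_le1.
Qed.

Lemma continuous_bessel : continuous bessel.
Proof.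
move=> u; apply: differentiable_continuous; apply/derivable1_diffP.
by have [] := is_derive_bessel u.
Qed.

End bessel.

Section laplace.
Context {R : realType}.
Local Notation mu := (@lebesgue_measure R).
Local Notation D := (`[0 : R, +oo[%classic).
Implicit Types (b x : R).

(** An antiderivative of [x^n exp(- x / b)]. *)
Let prim b : nat -> R -> R := fix F n x :=
  if n is n'.+1 then - b * (x ^+ n * expR (- b^-1 * x)) + (n%:R * b) * F n' x
  else - b * expR (- b^-1 * x).

Let dexpX b n x : is_derive x (1 : R) (fun y => y ^+ n.+1 * expR (- b^-1 * y))
  (n.+1%:R * x ^+ n * expR (- b^-1 * x) + x ^+ n.+1 * (- b^-1 * expR (- b^-1 * x))).
Proof.
apply: is_derive_mul; last exact: is_derive_comp_mulM.
elim: n => [|n ih].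
  by refine (is_derive_conv (is_derive_ident x) _); rewrite expr0 mulr1.
rewrite (_ : (fun y : R => y ^+ n.+2) = fun y => y * y ^+ n.+1); last first.
  by apply/funext => y; rewrite exprS.
refine (is_derive_conv (is_derive_mul (is_derive_ident x) ih) _).
by rewrite !exprS; ring.
Qed.

Let dprim b n x : b != 0 ->
  is_derive x (1 : R) (prim b n) (x ^+ n * expR (- b^-1 * x)).
Proof.
move=> b0; elim: n x => [|n ih] x.
  refine (is_derive_conv (is_derive_mul (is_derive_const (- b) x)
    (is_derive_comp_mulM (is_derive_expR (- b^-1 * x)))) _).
  by rewrite expr0; field.
refine (is_derive_conv (is_derive_add (is_derive_mul (is_derive_const (- b) x) (dexpX b n x))
  (is_derive_mul (is_derive_const (n.+1%:R * b) x) (ih x))) _).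
by field.
Qed.

Let prim0 b n : prim b n 0 = - (n`!%:R * b ^+ n.+1).
Proof.
elim: n => [|n ih] /=; first by rewrite mulr0 expR0 fact0; ring.
rewrite ih exprS !mul0r mulr0 add0r factS natrM [b ^+ n.+2]exprS; ring.
Qed.

Let prim_cvg b n : 0 < b -> prim b n x @[x --> +oo] --> (0 : R).
Proof.
move=> b0; have h k : x ^+ k * expR (- b^-1 * x) @[x --> +oo] --> (0 : R).
  pose C := (k.+1)`!%:R * b ^+ k.+1.
  have C0 : 0 < C by rewrite mulr_gt0 ?exprn_gt0// ltr0n fact_gt0.
  apply/cvgrPdist_le => e e0.
  exists (C / e); split; first exact: num_real.
  move=> x Cx; have x0 : 0 < x by rewrite (le_lt_trans _ Cx)// divr_ge0// ltW.
  rewrite sub0r normrN ger0_norm ?mulr_ge0 ?expR_ge0 ?exprn_ge0 ?(ltW x0)//.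
  have := @expR_ge_term _ (b^-1 * x) k.+1; rewrite mulr_ge0 ?invr_ge0 ?(ltW b0) ?(ltW x0)//.
  move=> /(_ isT) hx.
  rewrite mulNr expRN -ler_pdivlMr ?invr_gt0 ?expR_gt0// invrK.
  apply: le_trans (ler_wpM2l (ltW e0) hx).
  rewrite exprMn exprVn [x ^+ k.+1]exprS.
  rewrite (_ : e * _ = (e / C * x) * x ^+ k); last first.
    by rewrite /C; field; rewrite expf_neq0 ?gt_eqF// pnatr_eq0 -lt0n fact_gt0.
  rewrite -[leLHS]mul1r ler_wpM2r ?exprn_ge0 ?(ltW x0)//.
  have := ler_wpM2l (ltW (divr_gt0 e0 C0)) (ltW Cx).
  by rewrite (_ : e / C * (C / e) = 1)//; field; rewrite !gt_eqF.
elim: n => [|n ih] /=.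
  rewrite -[0](mulr0 (- b)); apply: cvgMl_tmp.
  by have := h 0%N; under eq_fun do rewrite expr0 mul1r.
rewrite -[0]addr0; apply: cvgD.
  by rewrite -[0](mulr0 (- b)); apply: cvgMl_tmp; exact: h.
by rewrite -[0](mulr0 (n.+1%:R * b)); apply: cvgMl_tmp.
Qed.

Let cont_prim b n : b != 0 -> continuous (prim b n).
Proof.
move=> b0 x; apply: differentiable_continuous; apply/derivable1_diffP.
by have [] := dprim n x b0.
Qed.

Let cont_f b n : continuous (fun x => x ^+ n * expR (- b^-1 * x)).
Proof.
move=> x; apply: cvgM; first exact: exprn_continuous.
apply: (@continuous_comp _ _ _ (fun y : R => - b^-1 * y) expR).
  by apply: cvgMl_tmp; exact: cvg_id.
exact: continuous_expR.
Qed.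

(** Euler's integral for the factorial. *)
Lemma integral_gamma b n : 0 < b ->
  (\int[mu]_(x in D) (x ^+ n * expR (- b^-1 * x))%:E = (n`!%:R * b ^+ n.+1)%:E)%E.
Proof.
move=> b0; have bn0 : b != 0 by rewrite gt_eqF.
rewrite (@ge0_continuous_FTC2y _ _ (prim b n) 0 0).
- by rewrite prim0 -EFinB sub0r opprK.
- by move=> x x0; rewrite mulr_ge0 ?expR_ge0// exprn_ge0.
- by apply: continuous_subspaceT; exact: cont_f.
- exact: prim_cvg.
- by move=> x _; have [] := dprim n x bn0.
- by apply: cvg_at_right_filter; exact: cont_prim.
- by move=> x _; rewrite derive1E; have [] := dprim n x bn0.
Qed.

Lemma integrable_gamma b n : 0 < b ->
  mu.-integrable D (EFin \o (fun x => x ^+ n * expR (- b^-1 * x))).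
Proof.
move=> b0; apply/integrableP; split.
  by apply/measurable_EFinP; apply: measurable_funTS; exact: continuous_measurable_fun (@cont_f b n).
apply: (@le_lt_trans _ _ (\int[mu]_(x in D) (x ^+ n * expR (- b^-1 * x))%:E)%E); last first.
  by rewrite integral_gamma// ltry.
rewrite le_eqVlt; apply/orP; left; apply/eqP; apply: eq_integral => x.
rewrite inE/= in_itv/= andbT => x0.
by rewrite ger0_norm// mulr_ge0 ?expR_ge0// exprn_ge0.
Qed.

Lemma Rintegral_gamma b n : 0 < b ->
  \int[mu]_(x in D) (x ^+ n * expR (- b^-1 * x)) = n`!%:R * b ^+ n.+1.
Proof. by move=> b0; rewrite /Rintegral integral_gamma. Qed.

Lemma integrable_expRN b : 0 < b -> mu.-integrable D (EFin \o (fun x => expR (- b^-1 * x))).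
Proof.
move=> b0; have := integrable_gamma 0 b0.
by under [X in _.-integrable _ (_ \o X) -> _]eq_fun do rewrite expr0 mul1r.
Qed.

(** Termwise integration; the partial sums of the Bessel series at [rho x] are
    dominated by [exp(2 b rho) exp(x / (2 b))]. *)
Lemma laplace_bessel b rho : 0 < b -> 0 <= rho ->
  \int[mu]_(x in D) (expR (- b^-1 * x) * bessel (rho * x)) = b * expR (- (b * rho)).
Proof.
move=> b0 rho0; have bn0 : b != 0 by rewrite gt_eqF.
pose g x := expR (2 * b * rho) * expR (- (2 * b)^-1 * x).
have bb0 : 0 < 2 * b by rewrite mulr_gt0.
pose u n x := \sum_(0 <= k < n) bessel_coef k * rho ^+ k * (x ^+ k * expR (- b^-1 * x)).
have uE n x : u n x = expR (- b^-1 * x) * pseries bessel_coef (rho * x) n.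
  rewrite /u /pseries/= /series/= mulr_sumr; apply: eq_bigr => k _.
  by rewrite exprMn; ring.
have hint k := integrable_gamma k b0.
have iu n : mu.-integrable D (EFin \o u n).
  elim: n => [|n ih].
    rewrite (_ : EFin \o _ = cst 0%E); first exact: integrable0.
    by apply/funext => x; rewrite /u /= big_geq.
  rewrite (_ : EFin \o _ = (EFin \o u n) \+
    (fun x => (bessel_coef n * rho ^+ n)%:E * (x ^+ n * expR (- b^-1 * x))%:E))%E.
    by apply: integrableD => //; apply: integrableZl => //; exact: hint.
  by apply/funext => x; rewrite /u /= big_nat_recr.
have [_ cvg1] : mu.-integrable D (EFin \o (fun x => expR (- b^-1 * x) * bessel (rho * x))) /\
    (fun n => \int[mu]_(x in D) u n x) @ \oo -->
    \int[mu]_(x in D) (expR (- b^-1 * x) * bessel (rho * x)).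
  apply: (@dominated_cvg_Rintegral _ _ _ mu D _ u _ g) => //.
  - move=> n; apply: measurable_funTS; apply: measurable_sum => k.
    by apply: measurable_funM => //; exact: continuous_measurable_fun (@cont_f b k).
  - move=> x _; have h : (fun n => expR (- b^-1 * x) * pseries bessel_coef (rho * x) n) @ \oo
        --> expR (- b^-1 * x) * bessel (rho * x).
      by apply: cvgMl_tmp; exact: exp_bounded_cvg bessel_coef_bounded.
    by apply: (cvgn_ext h) => n; exact: uE.
  - exact: (integrableZl _ (expR (2 * b * rho)) (integrable_expRN bb0)).
  - move=> n x; rewrite /= in_itv/= andbT => x0; rewrite uE normrM ger0_norm ?expR_ge0//.
    have -> : g x = expR (- b^-1 * x) * (expR (2 * b * rho) * expR (x / (2 * b))).
      rewrite /g [RHS]mulrCA; congr (_ * _); rewrite -expRD; congr expR; field.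
      by rewrite bn0.
    rewrite ler_wpM2l ?expR_ge0//.
    have xb0 : 0 <= x / (2 * b) by rewrite divr_ge0// ltW.
    have br0 : 0 <= 2 * b * rho by rewrite mulr_ge0// ltW.
    apply: (le_trans (ler_norm_sum _ _ _)).
    apply: (le_trans _ (ler_wpM2l (expR_ge0 _) (expR_ge_series n xb0))).
    rewrite mulr_sumr; apply: ler_sum => k _.
    have -> : `|bessel_coef k * (rho * x) ^+ k| =
        (2 * b * rho) ^+ k / k`!%:R * ((x / (2 * b)) ^+ k / k`!%:R).
      rewrite normrM /bessel_coef normrM normrX normrN1 expr1n mul1r ger0_norm; last first.
        by rewrite invr_ge0 exprn_ge0.
      rewrite ger0_norm ?exprn_ge0 ?mulr_ge0// !exprMn exprVn !exprMn.
      by field; rewrite !expf_neq0 ?bn0//= pnatr_eq0 -lt0n fact_gt0.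
    rewrite ler_wpM2r ?divr_ge0 ?exprn_ge0//; exact: expR_ge_term.
apply: (cvg_unique _ cvg1) => //.
have h : (fun n => b * series (fun k => (- (b * rho)) ^+ k / k`!%:R) n) @ \oo -->
    b * expR (- (b * rho)).
  by apply: cvgMl_tmp; exact: cvg_series_expR.
apply: (cvgn_ext h) => n.
rewrite /series/= mulr_sumr /u.
elim: n => [|n ih].
  under eq_Rintegral do rewrite big_geq//; rewrite big_geq//.
  by rewrite Rintegral_cst ?mul0r.
under eq_Rintegral do rewrite big_nat_recr//=.
rewrite RintegralD//; last 2 first.
- exact: iu.
- exact: (integrableZl _ (bessel_coef n * rho ^+ n) (hint n)).
rewrite big_nat_recr//= ih; congr (_ + _).
rewrite RintegralZl//.
rewrite Rintegral_gamma// /bessel_coef [(- (b * rho)) ^+ n]exprNn exprMn [b ^+ n.+1]exprS.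
by field; rewrite pnatr_eq0 -lt0n fact_gt0.
Qed.

End laplace.

(** * The Borel transform on the half-line *)

Section borel_laplace.
Context {R : realType} {d : nat}.
Local Notation V := 'rV[R]_d.
Local Notation BV := (borel_rV R d).
Variables (P : probability BV R) (phi : V).
Hypothesis eP : exp_moments P.

(** The squared Euclidean norm of [phi + x]; the norm [`|x|] of a row
    vector is its maximum norm. *)
Definition sqdist (x : V) : R := dot (phi + x) (phi + x).

Lemma sqdist_ge0 x : 0 <= sqdist x.
Proof. by apply: sumr_ge0 => i _; rewrite -expr2 sqr_ge0. Qed.

Lemma exp_type_sqdist : exp_type sqdist.
Proof.
have ei i : exp_type (fun x : V => (phi + x) 0 i).
  under eq_fun do rewrite mxE; apply: exp_typeD; first exact: exp_type_cst.
  exact: exp_type_coord.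
by apply: exp_type_sum => i _; exact: exp_typeM.
Qed.

Lemma sqdist_le (x : V) : sqdist x <= d%:R * (`|phi| + `|x|) ^+ 2.
Proof.
have -> : d%:R * (`|phi| + `|x|) ^+ 2 = \sum_(i < d) (`|phi| + `|x|) ^+ 2.
  by rewrite sumr_const card_ord mulr_natl.
apply: ler_sum => i _.
rewrite -expr2 -real_normK ?num_real// lerXn2r ?nnegrE ?addr_ge0//.
exact: le_trans (normr_coord _ _) (ler_normD _ _).
Qed.

(** The moments of the squared norm. *)
Definition sqmoment (m : nat) : R := \int[P]_x (sqdist x ^+ m).

(** A bound, of exponential type in [x], of the partial sums of the Bessel series
    at [sqdist x * tau]: since [tau * sqdist x <= q^2 (|phi| + |x|)^2] for
    [q = 1 + tau d], the terms are at most products of two terms of the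
    exponential series at [q (|phi| + |x|)]. *)
Let envelope (tau : R) (x : V) : R :=
  expR (2 * (1 + tau * d%:R) * `|phi|) * expR (2 * (1 + tau * d%:R) * `|x|).

Let iP (f : V -> R) : exp_type f -> P.-integrable setT (EFin \o f).
Proof. by move=> ef; exact: exp_type_integrable eP ef. Qed.

Let exp_type_envelope tau : exp_type (envelope tau).
Proof. by apply: exp_typeZ; exact: exp_type_expnorm. Qed.

Let sum_le_envelope tau x n : 0 <= tau ->
  \sum_(0 <= k < n) (tau ^+ k / (k`!%:R ^+ 2)) * sqdist x ^+ k <= envelope tau x.
Proof.
move=> tau0; pose q : R := 1 + tau * d%:R; pose v := `|phi| + `|x|.
have q0 : 0 <= q by rewrite addr_ge0// mulr_ge0.
have v0 : 0 <= v by rewrite addr_ge0.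
have qv0 : 0 <= q * v by rewrite mulr_ge0.
have td0 : 0 <= tau * d%:R by rewrite mulr_ge0.
have le1 : tau * sqdist x <= (q * v) ^+ 2.
  apply: (@le_trans _ _ (tau * (d%:R * v ^+ 2))).
    by rewrite ler_wpM2l// sqdist_le.
  rewrite mulrA exprMn ler_wpM2r ?exprn_ge0// /q.
  by rewrite sqrrD expr1n mul1r; have := sqr_ge0 (tau * d%:R); lra.
have -> : envelope tau x = expR (q * v) * expR (q * v).
  by rewrite /envelope -!expRD; congr expR; rewrite /q /v; ring.
apply: (le_trans _ (ler_wpM2l (expR_ge0 _) (expR_ge_series n qv0))).
rewrite mulr_sumr; apply: ler_sum => k _.
have -> : tau ^+ k / k`!%:R ^+ 2 * sqdist x ^+ k = (tau * sqdist x) ^+ k / k`!%:R / k`!%:R.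
  by rewrite exprMn; field; rewrite pnatr_eq0 -lt0n fact_gt0.
rewrite mulrA ler_wpM2r ?invr_ge0//.
apply: (@le_trans _ _ ((q * v) ^+ k / k`!%:R * (q * v) ^+ k)); last first.
  by rewrite ler_wpM2r ?exprn_ge0// expR_ge_term.
rewrite [leRHS](_ : _ = ((q * v) ^+ 2) ^+ k / k`!%:R); last by rewrite expr2 !exprMn; ring.
rewrite ler_wpM2r ?invr_ge0// lerXn2r ?nnegrE ?exprn_ge0// mulr_ge0//.
exact: sqdist_ge0.
Qed.

Let Rintegral_partial (c : nat -> R) n :
  \int[P]_x (\sum_(0 <= k < n) c k * sqdist x ^+ k) = \sum_(0 <= k < n) c k * sqmoment k.
Proof.
have ek k : exp_type (fun x => c k * sqdist x ^+ k).
  by apply: exp_typeZ; apply: exp_typeX; exact: exp_type_sqdist.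
elim: n => [|n ih].
  under eq_Rintegral do rewrite big_geq//; rewrite big_geq//.
  by rewrite Rintegral_cst ?mul0r.
under eq_Rintegral do rewrite big_nat_recr//=.
rewrite RintegralD//; [|by apply: iP; apply: exp_type_sum => k _|exact: iP].
rewrite big_nat_recr//= ih RintegralZl//.
by apply: iP; apply: exp_typeX; exact: exp_type_sqdist.
Qed.

Lemma sqmoment_ge0 m : 0 <= sqmoment m.
Proof. by apply: Rintegral_ge0 => x _; rewrite exprn_ge0// sqdist_ge0. Qed.

Lemma is_cvg_sqmoment tau : 0 <= tau ->
  cvgn (series (fun m => tau ^+ m / (m`!%:R ^+ 2) * sqmoment m)).
Proof.
move=> tau0; apply: nondecreasing_is_cvgn.
  apply: nondecreasing_series => k _ _.
  by rewrite !mulr_ge0 ?invr_ge0 ?exprn_ge0// sqmoment_ge0.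
exists (\int[P]_x envelope tau x) => _ [n _ <-].
rewrite /series/= -Rintegral_partial; apply: le_Rintegral => //.
- apply: iP; apply: exp_type_sum => k _; apply: exp_typeZ.
  by apply: exp_typeX; exact: exp_type_sqdist.
- exact: iP.
- by move=> x _; exact: sum_le_envelope.
Qed.

(** The Borel transform at [tau >= 0], as a mean of Bessel functions. *)
Definition borel_real (tau : R) : R := \int[P]_x bessel (sqdist x * tau).

Lemma cvg_borel_real tau : 0 <= tau ->
  series (fun m => bessel_coef m * tau ^+ m * sqmoment m) @ \oo --> borel_real tau.
Proof.
move=> tau0.
pose u n (x : BV) : R := \sum_(0 <= k < n) bessel_coef k * tau ^+ k * sqdist x ^+ k.
have [_ h] : P.-integrable setT (EFin \o (fun x : BV => bessel (sqdist x * tau))) /\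
    (fun n => \int[P]_x u n x) @ \oo --> \int[P]_x bessel (sqdist x * tau).
  apply: (@dominated_cvg_Rintegral _ _ _ P setT _ u _ (envelope tau)) => //.
  - move=> n; have [] : exp_type (u n).
      apply: exp_type_sum => k _; apply: exp_typeZ.
      by apply: exp_typeX; exact: exp_type_sqdist.
    by [].
  - move=> x _; apply: (cvgn_ext (exp_bounded_cvg (x := sqdist x * tau) (@bessel_coef_bounded R))) => n.
    rewrite /u /pseries/= /series/=; apply: eq_bigr => k _.
    by rewrite exprMn; ring.
  - exact: iP.
  - move=> n x _; apply: (le_trans (ler_norm_sum _ _ _)).
    apply: (le_trans _ (sum_le_envelope x n tau0)); apply: ler_sum => k _.
    rewrite /bessel_coef !normrM [`|(-1) ^+ k|]normrX normrN1 expr1n mul1r.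
    rewrite !ger0_norm ?invr_ge0 ?exprn_ge0 ?sqdist_ge0//.
    by rewrite [_^-1 * _]mulrC.
apply: (cvgn_ext h) => n; rewrite /series/= -Rintegral_partial.
by [].
Qed.

Local Notation mu := (@lebesgue_measure R).
Local Notation D := (`[0 : R, +oo[%classic).

(** Fubini's theorem, with [exp(- tau / b)] as an integrable bound. *)
Lemma laplace_borel_real b : 0 < b ->
  mu.-integrable D (EFin \o (fun tau => expR (- b^-1 * tau) * borel_real tau)) /\
  \int[mu]_(tau in D) (expR (- b^-1 * tau) * borel_real tau) =
  \int[P]_x (b * expR (- (b * sqdist x))).
Proof.
move=> b0.
pose T1 : measurableType _ := measurableTypeR R.
pose k (tau : R) (x : BV) : R := expR (- b^-1 * tau) * bessel (sqdist x * tau).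
pose h (p : T1 * BV) : R := k p.1 p.2 * \1_D p.1.
have mexp : measurable_fun setT (fun tau : T1 => expR (- b^-1 * tau)).
  by apply: measurableT_comp => //; apply: measurable_funM.
have [msq _] := exp_type_sqdist.
have mk : measurable_fun setT (fun p : T1 * BV => k p.1 p.2).
  apply: measurable_funM.
    exact: (measurableT_comp mexp measurable_fst).
  apply: (@measurableT_comp _ _ _ _ _ _ (@bessel R)).
    exact: continuous_measurable_fun (@continuous_bessel R).
  apply: measurable_funM; last exact: measurable_fst.
  exact: (measurableT_comp msq measurable_snd).
have mh : measurable_fun setT h.
  apply: measurable_funM => //.
  by apply: measurableT_comp; [exact: measurable_indic|exact: measurable_fst].
have kle tau x : 0 <= tau -> `|k tau x| <= expR (- b^-1 * tau).
  move=> tau0; rewrite normrM ger0_norm ?expR_ge0// -[leRHS]mulr1 ler_wpM2l ?expR_ge0//.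
  by apply: normr_bessel_le1; rewrite mulr_ge0 ?sqdist_ge0.
have hle tau x : `|h (tau, x)| <= expR (- b^-1 * tau) * \1_D tau.
  rewrite /h /= normrM [`|\1__ _|]ger0_norm// /indic; case: (boolP (tau \in D)) => tauD.
    by rewrite !mulr1; apply: kle; move: tauD; rewrite inE/= in_itv/= andbT.
  by rewrite !mulr0.
have mf : measurable_fun setT (EFin \o h) by exact/measurable_EFinP.
have iexp : mu.-integrable setT (fun tau : T1 => (expR (- b^-1 * tau) * \1_D tau)%:E).
  have := (integrable_mkcond (fun tau : T1 => (expR (- b^-1 * tau))%:E)
    (measurable_itv `[0 : R, +oo[)).1 (integrable_expRN b0).
  apply: eq_integrable => // tau _; rewrite /patch /indic /=.
  by case: (tau \in D); rewrite ?mulr1 ?mulr0.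
have iprod : (mu \x P)%E.-integrable setT (EFin \o h).
  apply/(integrable12ltyP _ _ mf).
  have /integrableP[_ ] := iexp; apply: le_lt_trans.
  apply: ge0_le_integral => //.
  - by move=> tau _; apply: integral_ge0.
  - apply: (measurable_fun_fubini_tonelli_F (m2 := P) (abse \o (EFin \o h))) => //.
    + exact: (measurableT_comp (@abse_measurable R setT) mf).
    + by move=> p; exact: abse_ge0.
  - have /integrableP[miexp _] := iexp; exact: (measurableT_comp (@abse_measurable R setT) miexp).
  move=> tau _; rewrite gee0_abs ?lee_fin ?mulr_ge0 ?expR_ge0//.
  apply: (@le_trans _ _ (\int[P]_x (cst (expR (- b^-1 * tau) * \1_D tau)%:E x))%E).
    apply: ge0_le_integral => //.
    + exact: (measurableT_comp (@abse_measurable R setT) (measurable_fun_pair2 tau mf)).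
    + by move=> x _; rewrite lee_fin hle.
  by rewrite integral_cst// [X in (_ * X)%E](@probability_setT _ _ _ P) mule1.
have intS tau : 0 <= tau -> P.-integrable setT (EFin \o (fun x : BV => bessel (sqdist x * tau))).
  move=> tau0; apply: iP; apply: (exp_type_bounded (C := 1)).
    apply: (@measurableT_comp _ _ _ _ _ _ (@bessel R)).
      exact: continuous_measurable_fun (@continuous_bessel R).
    by apply: measurable_funM.
  by move=> x; apply: normr_bessel_le1; rewrite mulr_ge0 ?sqdist_ge0.
have Fin tau : fubini_F P (EFin \o h) tau =
    ((EFin \o (fun tau => expR (- b^-1 * tau) * borel_real tau)) \_ D) tau.
  rewrite /fubini_F /= patchE; case: ifPn => tauD; last first.
    by rewrite integral0_eq// => x _; rewrite /h /= indicE (negPf tauD) mulr0.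
  have tau0 : 0 <= tau by move: tauD; rewrite inE/= in_itv/= andbT.
  under eq_integral do rewrite /h /= indicE tauD mulr1 /k.
  rewrite -[LHS]fineK; last first.
    apply: integrable_fin_num => //.
    exact: (integrableZl measurableT (expR (- b^-1 * tau)) (intS tau tau0)).
  by congr EFin; rewrite -[LHS]/(\int[P]_x (expR (- b^-1 * tau) * bessel (sqdist x * tau)))
    RintegralZl//; exact: intS.
have Gin x : fubini_G mu (EFin \o h) x = (b * expR (- (b * sqdist x)))%:E.
  rewrite /fubini_G -laplace_bessel ?sqdist_ge0// [RHS]fineK; last first.
    apply: integrable_fin_num => //.
    apply: le_integrable (integrable_expRN b0) => //.
      apply: measurable_funTS; apply/measurable_EFinP.
      exact: (measurable_fun_pair1 x mk).
    move=> tau; rewrite /= in_itv/= andbT => tau0; rewrite lee_fin.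
    by rewrite [leRHS]ger0_norm ?expR_ge0//; exact: kle.
  rewrite [RHS]integral_mkcond; apply: eq_integral => tau _.
  rewrite patchE /= /h /= /indic; case: (tau \in D); first by rewrite mulr1.
  by rewrite mulr0.
have F := integrable_fubini_F iprod.
have Fub := Fubini iprod.
have FD : fubini_F P (EFin \o h) =
    (EFin \o (fun tau => expR (- b^-1 * tau) * borel_real tau)) \_ D.
  by apply/funext => tau; exact: Fin.
split.
  have F' := F; rewrite FD in F'.
  refine ((integrable_mkcond (mu := mu) (EFin \o (fun tau => expR (- b^-1 * tau) * borel_real tau))
    (measurable_itv `[0 : R, +oo[)).2 F').
rewrite /Rintegral integral_mkcond -FD; congr fine.
rewrite -[LHS]/(\int[mu]_tau fubini_F P (EFin \o h) tau)%E.
transitivity (\int[P]_x fubini_G mu (EFin \o h) x)%E; first exact: Fub.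
by apply: eq_integral => x _; exact: Gin.
Qed.

End borel_laplace.

(** * Convergence in the complex plane *)

Section complex_modulus.
Local Open Scope complex_scope.
Context {R : realType}.
Implicit Types (z w c : R[i]) (e : R).
Local Notation N := (@Normc.normc R).

Lemma normc_ge0 z : 0 <= N z.
Proof. by case: z => a b; exact: sqrtr_ge0. Qed.

Lemma normcX z n : N (z ^+ n) = N z ^+ n.
Proof.
elim: n => [|n ih]; first by rewrite !expr0 Normc.normc1.
by rewrite !exprS Normc.normcM ih.
Qed.

Lemma normc_real (x : R) : N x%:C = `|x|.
Proof. by rewrite /Normc.normc /= expr0n/= addr0 sqrtr_sqr. Qed.

Lemma normc_le0 z : N z <= 0 -> z = 0.
Proof. by move=> z0; apply/Normc.eq0_normc/le_anti; rewrite z0 normc_ge0. Qed.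

Lemma normc_sum (I : Type) (s : seq I) (P : pred I) (F : I -> R[i]) :
  N (\sum_(i <- s | P i) F i) <= \sum_(i <- s | P i) N (F i).
Proof.
elim/big_ind2 : _ => [|x a y b xa yb|//]; first by rewrite Normc.normc0.
exact: le_trans (le_normcD _ _) (lerD xa yb).
Qed.

Lemma normcBC z w : N (z - w) = N (w - z).
Proof. by rewrite -normcN opprB. Qed.

Lemma normc_Re z : `|complex.Re z| <= N z.
Proof.
case: z => a b; rewrite /Normc.normc /= -sqrtr_sqr ler_wsqrtr//.
by rewrite lerDl sqr_ge0.
Qed.

Lemma normc_Im z : `|complex.Im z| <= N z.
Proof.
case: z => a b; rewrite /Normc.normc /= -sqrtr_sqr ler_wsqrtr//.
by rewrite lerDr sqr_ge0.
Qed.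

Lemma normc_le_ReIm z : N z <= `|complex.Re z| + `|complex.Im z|.
Proof.
case: z => a b; rewrite [in leLHS](_ : a +i* b = a%:C + 'i * b%:C); last first.
  by apply/eqP; rewrite eq_complex /= !(mul0r, mul1r, mulr0, subr0, addr0, add0r) !eqxx.
apply: (le_trans (le_normcD _ _)); rewrite Normc.normcM !normc_real.
rewrite (_ : N 'i = 1) ?mul1r//.
by rewrite /Normc.normc/= expr0n/= expr1n add0r sqrtr1.
Qed.

Lemma normrC_E z : `|z| = (N z)%:C. Proof. by []. Qed.

Lemma gt0C (e : R[i]) : 0 < e -> e = (complex.Re e)%:C /\ 0 < complex.Re e.
Proof. by case: e => a b; rewrite ltcE /= => /andP[/eqP-> a0]. Qed.

(** Neighbourhoods in the complex plane have complex radii, with imaginary part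
    0; real radii are enough. *)
Lemma nearCP (c : R[i]) (P : R[i] -> Prop) : (\forall w \near c, P w) <->
  exists2 e : R, 0 < e & forall w, N (w - c) < e -> P w.
Proof.
split=> [/nbhs_ballP[e /= /gt0C[-> e0] eP]|[e e0 eP]].
  by exists (complex.Re e) => // w wc; apply: eP; rewrite /ball/= normrC_E ltcR normcBC.
apply/nbhs_ballP; exists e%:C; first by rewrite /= ltcR.
by move=> w; rewrite /ball/= normrC_E ltcR normcBC; exact: eP.
Qed.

Lemma cvgCP (u : nat -> R[i]) (l : R[i]) : u @ \oo --> l <->
  forall e : R, 0 < e -> exists K, forall n, (K <= n)%N -> N (u n - l) < e.
Proof.
split=> [/cvgrPdist_lt ul e e0|ul].
  have [|K _ Ku] := ul e%:C; first by rewrite ltcR.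
  by exists K => n Kn; have := Ku n Kn; rewrite /= normrC_E ltcR normcBC.
apply/cvgrPdist_lt => e /gt0C[-> e0]; have [K Ku] := ul _ e0.
by exists K => // n Kn /=; rewrite normrC_E ltcR normcBC; exact: Ku.
Qed.

Lemma cvgC_unique (u : nat -> R[i]) (l l' : R[i]) :
  u @ \oo --> l -> u @ \oo --> l' -> l = l'.
Proof.
move=> /cvgCP ul /cvgCP ul'; apply/eqP; rewrite -subr_eq0; apply/eqP/normc_le0.
rewrite leNgt; apply/negP => h; have h2 : 0 < N (l - l') / 2 by rewrite divr_gt0.
have [K Kl] := ul _ h2; have [K' Kl'] := ul' _ h2.
have := Kl (maxn K K') (leq_maxl _ _); have := Kl' (maxn K K') (leq_maxr _ _).
set a := u _ => h3 h4; have := le_normcD (l - a) (a - l').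
rewrite addrA subrK [N (l - a)]normcBC => h5.
by have := le_lt_trans h5 (ltrD h4 h3); rewrite -splitr ltxx.
Qed.

Lemma cvgC_ext (u v : nat -> R[i]) (l : R[i]) : u @ \oo --> l -> (forall n, v n = u n) -> v @ \oo --> l.
Proof. by move=> ul vu; rewrite (_ : v = u)//; apply/funext. Qed.

Lemma cvgC_ReIm (u : nat -> R[i]) (a b : R) :
  (fun n => complex.Re (u n)) @ \oo --> a -> (fun n => complex.Im (u n)) @ \oo --> b ->
  u @ \oo --> (a +i* b).
Proof.
move=> /cvgrPdist_lt ua /cvgrPdist_lt ub; apply/cvgCP => e e0.
have e2 : 0 < e / 2 by rewrite divr_gt0.
have [K _ Ka] := ua _ e2; have [K' _ Kb] := ub _ e2.
exists (maxn K K') => n; rewrite geq_max => /andP[Kn Kn'].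
apply: (le_lt_trans (normc_le_ReIm _)); rewrite [e]splitr.
have := Ka n Kn; have := Kb n Kn'; rewrite /= => h1 h2.
case: (u n) h1 h2 => x y /= h1 h2.
by rewrite distrC [`|y - b|]distrC; exact: ltrD.
Qed.

Lemma cvgC_normc_le (u : nat -> R[i]) (l : R[i]) (A : R) K :
  u @ \oo --> l -> (forall n, (K <= n)%N -> N (u n) <= A) -> N l <= A.
Proof.
move=> /cvgCP ul uA; rewrite leNgt; apply/negP => h.
have h2 : 0 < N l - A by rewrite subr_gt0.
have [K' Kl] := ul _ h2; have := Kl _ (leq_maxr K K'); rewrite normcBC => h3.
have := le_normcD (l - u (maxn K K')) (u (maxn K K')); rewrite subrK => h4.
have := le_lt_trans h4 (ltr_leD h3 (uA _ (leq_maxl K K'))).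
by rewrite subrK ltxx.
Qed.

(** Absolute convergence implies convergence. *)
Lemma normed_cvgC (a : nat -> R[i]) : cvgn (series (fun n => N (a n))) ->
  exists l : R[i], series a @ \oo --> l.
Proof.
move=> ca; have [cr ci] : cvgn (series (fun n => complex.Re (a n))) /\
    cvgn (series (fun n => complex.Im (a n))).
  split; apply: normed_cvg.
  - apply: (series_le_cvg _ _ (fun n => normc_Re (a n)) ca) => n //.
    exact: normc_ge0.
  - apply: (series_le_cvg _ _ (fun n => normc_Im (a n)) ca) => n //.
    exact: normc_ge0.
move/cvg_ex : cr => [x xr]; move/cvg_ex : ci => [y yi]; exists (x +i* y).
apply: cvgC_ReIm; [apply: (cvgn_ext xr)|apply: (cvgn_ext yi)] => n;
  by rewrite /series/= raddf_sum.
Qed.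

End complex_modulus.

(** * Recentring of power series *)

Section complex_power_series.
Local Open Scope complex_scope.
Context {R : realType}.
Implicit Types (w c h l : R[i]) (u v : nat -> R[i]).
Local Notation N := (@Normc.normc R).

Lemma cvgCB u v l l' : u @ \oo --> l -> v @ \oo --> l' ->
  (fun n => u n - v n) @ \oo --> l - l'.
Proof. exact: cvgB. Qed.

Lemma cvgC_cst w : (fun=> w) @ \oo --> w.
Proof. exact: cvg_cst. Qed.

Lemma cvgC_cvgn u l : u @ \oo --> l -> cvgn u.
Proof. by move=> ul; apply/cvg_ex; exists l. Qed.

Lemma cvgCMr u l w : u @ \oo --> l -> (fun n => u n * w) @ \oo --> l * w.
Proof.
move=> ul; rewrite mulrC; apply: (@cvgC_ext _ (fun n => w *: u n)).
  exact: (cvgZl_tmp (k := w) ul).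
by move=> n; rewrite mulrC.
Qed.

Lemma cvgC_sum (F : nat -> nat -> R[i]) (L : nat -> R[i]) K :
  (forall i, F i @ \oo --> L i) ->
  (fun n => \sum_(i < K) F i n) @ \oo --> \sum_(i < K) L i.
Proof.
move=> FL; elim: K => [|K ih].
  rewrite big_ord0; apply: (cvgC_ext (cvgC_cst (w := 0))) => n.
  by rewrite big_ord0.
rewrite big_ord_recr/=.
apply: (@cvgC_ext _ (fun n => \sum_(i < K) F i n + F K n)) => [|n].
  exact: (cvgD ih (FL K)).
by rewrite big_ord_recr.
Qed.

(** The terms of the binomial expansion of [(w + h) ^+ m]; they vanish for
    [m < n]. *)
Let T w h (m n : nat) : R[i] := w ^+ (m - n) * h ^+ n *+ 'C(m, n).
Let TR (x y : R) (m n : nat) : R := x ^+ (m - n) * y ^+ n *+ 'C(m, n).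

Let T_ge w h m n : (m < n)%N -> T w h m n = 0.
Proof. by move=> mn; rewrite /T bin_small// mulr0n. Qed.

Let TR_ge0 x y m n : 0 <= x -> 0 <= y -> 0 <= TR x y m n.
Proof. by move=> x0 y0; rewrite mulrn_wge0// mulr_ge0// exprn_ge0. Qed.

Let sumT w h m K : (w + h) ^+ m = \sum_(0 <= n < K + m.+1) T w h m n.
Proof.
rewrite exprDn addnC (big_cat_nat _ (n := m.+1))//= ?leq_addr//.
rewrite [X in _ + X]big_nat_cond [X in _ + X]big1 => [|n /andP[/andP[mn _] _]].
  by rewrite addr0 big_mkord.
exact: T_ge.
Qed.

Let sumTR (x y : R) m : (x + y) ^+ m = \sum_(0 <= n < m.+1) TR x y m n.
Proof. by rewrite exprDn big_mkord. Qed.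

Let le_TR (x y : R) m n : 0 <= x -> 0 <= y -> TR x y m n <= (x + y) ^+ m.
Proof.
move=> x0 y0; have [nm|mn] := leqP n m; last first.
  by rewrite /TR bin_small// mulr0n exprn_ge0// addr_ge0.
rewrite sumTR (@big_cat_nat _ _ _ n)//=; last exact: leqW.
rewrite big_nat_recl//= addrCA lerDl addr_ge0//; apply: sumr_ge0 => *; exact: TR_ge0.
Qed.

(** For [n >= K], [y^n <= 2^-K (2 y)^n]. *)
Let sum_TR_le (x y : R) m K : 0 <= x -> 0 <= y ->
  \sum_(K <= n < K + m.+1) TR x y m n <= 2^-1 ^+ K * (x + 2 * y) ^+ m.
Proof.
move=> x0 y0; have y2 : 0 <= 2 * y by rewrite mulr_ge0.
apply: (@le_trans _ _ (\sum_(K <= n < K + m.+1) 2^-1 ^+ K * TR x (2 * y) m n)).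
  apply: ler_sum_nat => n /andP[Kn _]; rewrite /TR -mulrnAr.
  rewrite mulrnAr mulrnAr lerMn2r; apply/orP; right.
  rewrite mulrCA ler_wpM2l ?exprn_ge0// exprMn mulrA -{1}[y ^+ n]mul1r.
  rewrite ler_wpM2r ?exprn_ge0// -(subnK Kn) exprD mulrCA -exprMn mulVf//.
  by rewrite expr1n mulr1 exprn_ege1// ler1n.
rewrite -mulr_sumr ler_wpM2l ?exprn_ge0//.
rewrite exprDn -(big_mkord xpredT (fun n => TR x (2 * y) m n)).
rewrite [leRHS](_ : _ = \sum_(0 <= n < K + m.+1) TR x (2 * y) m n).
  by rewrite [leRHS](@big_cat_nat _ _ _ K)//= ?leq_addr// lerDr sumr_ge0// => *; exact: TR_ge0.
rewrite addnC [RHS](@big_cat_nat _ _ _ m.+1)//= ?leq_addr//.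
rewrite [X in _ = _ + X]big_nat_cond [X in _ = _ + X]big1 ?addr0// => n /andP[/andP[mn _] _].
by rewrite /TR bin_small// mulr0n.
Qed.

Let normcT w h m n : N (T w h m n) = TR (N w) (N h) m n.
Proof. by rewrite /T normcMn Normc.normcM !normcX. Qed.

(** An everywhere convergent power series can be expanded around any point [c].
    The remainder of order [K] of the expansion at [c + h] is at most [2^-K]
    times the sum of the moduli of the terms at [|c| + 2 |h|]. *)
Lemma entire_recenter c (S : R[i] -> R[i]) (a : nat -> R[i]) :
  (forall x : R, 0 <= x -> cvgn (series (fun m => N (a m) * x ^+ m))) ->
  (forall w, series (fun m => a m * w ^+ m) @ \oo --> S w) ->
  exists u, forall w, series (fun n => u n * (w - c) ^+ n) @ \oo --> S w.
Proof.
move=> aN aS.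
have /choice[u uE] n : exists l, series (fun m => a m * T c 1 m n) @ \oo --> l.
  apply: normed_cvgC.
  (* The coefficients of the expansion are dominated by the terms at [|c| + 1]. *)
  have c1 : 0 <= N c + 1 by rewrite addr_ge0// normc_ge0.
  have := aN _ c1; apply: series_le_cvg => m.
  - exact: normc_ge0.
  - by rewrite mulr_ge0 ?normc_ge0// exprn_ge0.
  - rewrite Normc.normcM ler_wpM2l ?normc_ge0// normcT Normc.normc1.
    by rewrite le_TR// normc_ge0.
exists u => w.
have [h ->] : exists h : R[i], w = c + h by exists (w - c); rewrite addrC subrK.
rewrite [c + h - c]addrC addKr.
have x0 : 0 <= N c + 2 * N h by rewrite addr_ge0 ?mulr_ge0// normc_ge0.
have cA := aN _ x0; set A := limn (series (fun m => N (a m) * (N c + 2 * N h) ^+ m)).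
have A0 : 0 <= A.
  apply: limr_ge => //; apply: nearW => n; rewrite /series/= sumr_ge0// => m _.
  by rewrite mulr_ge0 ?normc_ge0// exprn_ge0.
have key K : N (S (c + h) - series (fun n => u n * h ^+ n) K) <= 2^-1 ^+ K * A.
  have h1 : (fun M => series (fun m => a m * (c + h) ^+ m) M -
      \sum_(i < K) series (fun m => a m * T c 1 m i) M * h ^+ i) @ \oo -->
      S (c + h) - \sum_(i < K) u i * h ^+ i.
    apply: cvgCB => //.
    refine (@cvgC_sum (fun i M => series (fun m => a m * T c 1 m i) M * h ^+ i)
      (fun i => u i * h ^+ i) K _) => i.
    exact: (cvgCMr (w := h ^+ i) (uE i)).
  rewrite /series/= big_mkord; apply: (cvgC_normc_le (K := 0) h1) => M _.
  under [X in _ - X]eq_bigr do rewrite mulr_suml.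
  rewrite exchange_big/= -sumrB.
  apply: (le_trans (normc_sum _ _ _)).
  apply: (@le_trans _ _ (\sum_(0 <= m < M) N (a m) * (2^-1 ^+ K * (N c + 2 * N h) ^+ m))).
    apply: ler_sum => m _.
    have -> : a m * (c + h) ^+ m - \sum_(i < K) a m * T c 1 m i * h ^+ i =
        a m * \sum_(K <= n < K + m.+1) T c h m n.
      rewrite (sumT c h m K).
      rewrite (@big_cat_nat _ _ _ K)//= ?leq_addr// big_mkord mulrDr addrAC.
      rewrite mulr_sumr -sumrB big1 ?add0r// => i _.
      by rewrite /T expr1n mulr1 -!mulrA mulrnAl subrr.
    rewrite Normc.normcM ler_wpM2l ?normc_ge0//; apply: (le_trans (normc_sum _ _ _)).
    under eq_bigr do rewrite normcT.
    by rewrite sum_TR_le ?normc_ge0.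
  under eq_bigr do rewrite mulrCA.
  rewrite -mulr_sumr ler_wpM2l ?exprn_ge0//.
  apply: (nondecreasing_cvgn_le _ cA) => m n mn.
  rewrite /series/= [leRHS](@big_cat_nat _ _ _ m)//= lerDl sumr_ge0// => k _.
  by rewrite mulr_ge0 ?normc_ge0// exprn_ge0.
apply/cvgCP => e e0.
have : (fun K => A * 2^-1 ^+ K) @ \oo --> (0 : R).
  rewrite -(mulr0 A); apply: cvgMl_tmp; apply: cvg_expr.
  by rewrite ger0_norm// invf_lt1// ltr1n.
move=> /cvgrPdist_lt/(_ _ e0)[K _ Ke]; exists K => n /Ke/=.
rewrite sub0r normrN ger0_norm ?mulr_ge0 ?exprn_ge0// => h2.
rewrite normcBC; apply: le_lt_trans (key n) _; by rewrite mulrC.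
Qed.

End complex_power_series.

(** * The identity theorem along the half-line *)

(** Induction on the half-line: a property holding at 0, inherited by a right
    neighbourhood and by the limit from the left holds everywhere. *)
Lemma real_induction {R : realType} (P : R -> Prop) :
  P 0 ->
  (forall x, 0 <= x -> P x -> exists2 e, 0 < e & forall y, x <= y < x + e -> P y) ->
  (forall x, 0 < x -> (forall y, 0 <= y < x -> P y) -> P x) ->
  forall x, 0 <= x -> P x.
Proof.
move=> P0 Pright Pleft x x0; apply: contrapT => nPx.
pose E := [set y : R | 0 <= y /\ ~ P y].
have E0 : E !=set0 by exists x.
have lE : has_lbound E by exists 0 => y [].
have hE : has_inf E by [].
set b := inf E; have b0 : 0 <= b by apply: lb_le_inf => // y [].
have Pb y : 0 <= y < b -> P y.
  move=> /andP[y0 yb]; apply: contrapT => nPy.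
  have : b <= y by apply: ge_inf => //; split.
  by rewrite leNgt yb.
have Pbb : P b.
  have [b00|b00] := eqVneq b 0; first by rewrite b00.
  by apply: Pleft => //; rewrite lt_neqAle eq_sym b00.
have [e e0 Pe] := Pright _ b0 Pbb.
have : b + e <= b.
  apply: lb_le_inf => // y [y0 nPy]; rewrite leNgt; apply/negP => ybe.
  by apply: nPy; have [yb|by_] := ltP y b; [apply: Pb; rewrite y0|apply: Pe; rewrite by_].
by rewrite -lerBrDl subrr leNgt e0.
Qed.

Section identity_theorem.
Local Open Scope complex_scope.
Context {R : realType}.
Implicit Types (w c h l : R[i]) (u v : nat -> R[i]) (D : R[i] -> R[i]).
Local Notation N := (@Normc.normc R).

Let bounded_terms v l : series v @ \oo --> l ->
  exists2 M, 0 <= M & forall n, N (v n) <= M.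
Proof.
move=> /cvgCP/(_ _ ltr01)[K Kl].
have M0 : 0 <= \sum_(n < K) N (v n) by rewrite sumr_ge0// => *; exact: normc_ge0.
exists (2 + \sum_(n < K) N (v n)); first by rewrite addr_ge0.
move=> n; have [Kn|nK] := leqP K n.
  rewrite -[leLHS]addr0 lerD//.
  have -> : v n = (series v n.+1 - l) - (series v n - l).
    by rewrite /series/= big_nat_recr//= opprB addrA subrK addrC addrA addNr add0r.
  apply: (le_trans (le_normcD _ _)); rewrite normcN.
  by rewrite [2]splitr lerD//; apply: ltW; rewrite divff//; apply: Kl => //; exact: leqW.
rewrite (bigD1 (Ordinal nK))//= addrCA lerDl addr_ge0// sumr_ge0// => *; exact: normc_ge0.
Qed.

(** A geometric series of ratio at most 1/2 is at most twice its first term. *)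
Lemma geometric_tail_le (M q : R) n k : 0 <= M -> 0 <= q -> q <= 2^-1 ->
  \sum_(k <= i < n) M * q ^+ i <= 2 * M * q ^+ k.
Proof.
move=> M0 q0 q2; rewrite -mulr_sumr [2 * M]mulrC -mulrA ler_wpM2l//.
elim: n => [|n ih].
  by rewrite big_geq// mulr_ge0// exprn_ge0.
have [kn|nk] := leqP k n; last by rewrite big_geq// mulr_ge0// exprn_ge0.
suff : \sum_(k <= i < n.+1) q ^+ i <= 2 * q ^+ k - q ^+ n.
  by move/le_trans; apply; rewrite lerBlDr lerDl exprn_ge0.
move: kn {ih}; elim: n => [|n ih].
  rewrite leqn0 => /eqP->; rewrite big_nat1 !expr0; lra.
rewrite leq_eqVlt => /predU1P[->|kn].
  by rewrite big_nat1; set x := q ^+ _; lra.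
rewrite big_nat_recr//=; last exact: leqW.
have := ih kn; have : 0 <= q ^+ n by rewrite exprn_ge0.
rewrite exprS; set x := q ^+ n; set y := \sum_(_ <= _ < _) _; set w := q ^+ k => x0.
move=> h; nra.
Qed.

(** A power series whose zeros accumulate at its centre vanishes: at a zero
    [c + h], the first nonzero term would be bounded by the tail of the series,
    which is of smaller order in [h]. *)
Lemma pseries_zeros_acc D c v (e : R) : 0 < e ->
  (forall w, N (w - c) < e -> series (fun n => v n * (w - c) ^+ n) @ \oo --> D w) ->
  (forall e', 0 < e' -> exists w, [/\ w != c, N (w - c) < e' & D w = 0]) ->
  forall w, N (w - c) < e -> D w = 0.
Proof.
move=> e0 vD D0.
suff v0 : forall n, v n = 0.
  move=> w /vD vw; apply: (cvgC_unique vw).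
  apply: (@cvgC_ext _ (fun=> 0)) => [|n]; first exact: cvg_cst.
  by rewrite /series/= big1// => i _; rewrite v0 mul0r.
apply: ltn_ind => k vk.
pose rho := e / 2; have rho0 : 0 < rho by rewrite divr_gt0.
have rhoe : rho < e by rewrite /rho; lra.
have [M M0 vM] : exists2 M, 0 <= M & forall n, N (v n) * rho ^+ n <= M.
  have /vD/bounded_terms[M M0 vM] : N (c + rho%:C - c) < e.
    by rewrite addrC addKr normc_real ger0_norm// ltW.
  exists M => // n; have := vM n.
  by rewrite Normc.normcM addrC addKr normcX normc_real ger0_norm// ltW.
apply: normc_le0; rewrite leNgt; apply/negP => vk0.
have rk : 0 < rho ^+ k.+1 by rewrite exprn_gt0.
(* Closer zeros than [e'] contradict the comparison of the term of order [k] at a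
   zero with the tail. *)
pose e' := Num.min (rho / 2) (N (v k) * rho ^+ k.+1 / (2 * M + 1)).
have e'0 : 0 < e'.
  by rewrite lt_min divr_gt0//= divr_gt0 ?mulr_gt0// ltr_wpDl// mulr_ge0.
have [w [wc we Dw]] := D0 _ e'0.
move: we; rewrite lt_min => /andP[w1 w2].
set h := w - c in w1 w2; pose eta := N h.
have eta0 : 0 < eta.
  rewrite lt_neqAle normc_ge0 andbT eq_sym; apply: contra wc => /eqP/Normc.eq0_normc/eqP.
  by rewrite subr_eq0.
have /vD : N (w - c) < e by rewrite (lt_trans w1)// (lt_trans _ rhoe)// ltr_pdivrMr// ltr_pMr// ltr1n.
rewrite Dw -/h => vw.
have qle : eta / rho <= 2^-1 by rewrite ler_pdivrMr// mulrC ltW.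
have q0 : 0 <= eta / rho by rewrite divr_ge0// ltW.
have : N (v k * h ^+ k) <= 2 * M * (eta / rho) ^+ k.+1.
  have vw' := cvgCB vw (cvgC_cst (w := v k * h ^+ k)).
  rewrite -normcN -sub0r; apply: (cvgC_normc_le (K := k.+1) vw') => n kn.
  rewrite /series/= (@big_cat_nat _ _ _ k.+1)//= big_nat_recr//=.
  rewrite big_nat_cond big1 => [|i /andP[/andP[_ ik] _]]; last by rewrite vk// mul0r.
  rewrite add0r addrAC subrr add0r; apply: (le_trans (normc_sum _ _ _)).
  apply: (le_trans _ (geometric_tail_le n k.+1 M0 q0 qle)).
  apply: ler_sum => i _; rewrite Normc.normcM normcX -/eta exprMn exprVn mulrCA.
  by rewrite [leLHS]mulrC ler_wpM2l ?exprn_ge0 ?normc_ge0// ler_pdivlMr ?exprn_gt0// vM.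
rewrite Normc.normcM normcX -/eta exprMn exprVn mulrA ler_pdivlMr//.
rewrite [eta ^+ k.+1]exprS [leRHS]mulrA [leLHS]mulrAC ler_pM2r ?exprn_gt0//.
move: w2; rewrite -/eta ltr_pdivlMr ?ltr_wpDl ?mulr_ge0// => w2 /(lt_le_trans w2).
by rewrite mulrC ltr_pM2r// ltNge lerDl ler01.
Qed.

End identity_theorem.

Section identity_half_line.
Local Open Scope complex_scope.
Context {R : realType}.
Implicit Types (A : set R[i]) (B S : R[i] -> R[i]).
Local Notation N := (@Normc.normc R).

Lemma strip_real (sigma x : R) : 0 < sigma -> 0 <= x -> strip sigma x%:C.
Proof.
move=> s0 x0; rewrite /strip /mkset; apply: (@le_lt_trans _ _ 0); last by rewrite divr_gt0.
apply: ge_inf; last by exists x => //; rewrite subrr Normc.normc0.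
by exists 0 => y [s _ <-]; exact: normc_ge0.
Qed.

Lemma analytic_at_sub B S (c : R[i]) (u v : nat -> R[i]) :
  (\forall w \near c, series (fun n => u n * (w - c) ^+ n) @ \oo --> B w) ->
  (\forall w \near c, series (fun n => v n * (w - c) ^+ n) @ \oo --> S w) ->
  exists2 e : R, 0 < e & forall w, N (w - c) < e ->
    series (fun n => (u n - v n) * (w - c) ^+ n) @ \oo --> B w - S w.
Proof.
move=> /nearCP[e1 e10 uB] /nearCP[e2 e20 vS].
exists (Num.min e1 e2) => [|w]; first by rewrite lt_min e10.
rewrite lt_min => /andP[/uB uw /vS vw]; apply: (cvgC_ext (cvgCB uw vw)) => n.
by rewrite /series/= -sumrB; apply: eq_bigr => i _; rewrite mulrBl.
Qed.

(** The set of the [x] around which [B] and [S] agree is open on the right, and it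
    is closed on the left because the zeros of [B - S] then accumulate at [x]. *)
Lemma analytic_half_line A B S : (forall x : R, 0 <= x -> A x%:C) ->
  analytic_on A B -> analytic_on setT S -> (\forall w \near 0, B w = S w) ->
  forall x : R, 0 <= x -> B x%:C = S x%:C.
Proof.
move=> A0 anB anS /nearCP[e0 e00 BS0].
pose P (x : R) := exists2 e : R, 0 < e & forall w, N (w - x%:C) < e -> B w - S w = 0.
suff allP x : 0 <= x -> P x.
  move=> x /allP[e egt0 Be]; apply/eqP; rewrite -subr_eq0; apply/eqP/Be.
  by rewrite subrr Normc.normc0.
apply: real_induction => {x} [|x x0 [e egt0 Be]|x x0 Px].
- by exists e0 => // w we; rewrite BS0 ?subrr.
- exists e => // y /andP[xy yxe]; exists (e - (y - x)); first by lra.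
  move=> w we; apply: Be; rewrite -(subrK y%:C w) -addrA.
  apply: (le_lt_trans (le_normcD _ _)).
  rewrite -rmorphB normc_real ger0_norm ?subr_ge0//.
  by rewrite -ltrBrDr.
- have [u uB] := anB _ (A0 _ (ltW x0)); have [v vS] := anS x%:C I.
  have [e egt0 De] := analytic_at_sub uB vS.
  exists e => //; apply: (pseries_zeros_acc egt0 De) => e' e'0.
  pose m := Num.min x e'; have m0 : 0 < m by rewrite lt_min x0.
  have mx : m <= x by rewrite ge_min lexx.
  have me : m <= e' by rewrite ge_min lexx orbT.
  have [|e1 e10 Be] := Px (x - m / 2); first by apply/andP; split; lra.
  exists (x - m / 2)%:C; split.
  + by rewrite (inj_eq (@complexI _)); apply/eqP => h; lra.
  + by rewrite -rmorphB normc_real ltr_norml; apply/andP; split; lra.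
  + by apply: Be; rewrite subrr Normc.normc0.
Qed.

End identity_half_line.

(** * The Borel transform in the complex plane *)

Section complex_borel_transform.
Local Open Scope complex_scope.
Context {R : realType} {d : nat}.
Local Notation V := 'rV[R]_d.
Local Notation BV := (borel_rV R d).
Variables (P : probability BV R) (phi : V).
Hypothesis eP : exp_moments P.

(** The entire function defined by the Borel series. *)
Lemma complex_borel : exists S : R[i] -> R[i],
  [/\ forall w, series (fun m => (bessel_coef m * sqmoment P phi m)%:C * w ^+ m) @ \oo --> S w,
      analytic_on setT S &
      forall x : R, 0 <= x -> S x%:C = (borel_real P phi x)%:C].
Proof.
pose a m : R[i] := (bessel_coef m * sqmoment P phi m)%:C.
have aN (x : R) : 0 <= x -> cvgn (series (fun m => Normc.normc (a m) * x ^+ m)).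
  move=> x0; have := is_cvg_sqmoment (phi := phi) eP x0.
  rewrite (_ : (fun m => _) = (fun m => Normc.normc (a m) * x ^+ m))//.
  apply/funext => m; rewrite normc_real normrM [`|sqmoment _ _ _|]ger0_norm ?sqmoment_ge0//.
  rewrite /bessel_coef normrM normrX normrN1 expr1n mul1r ger0_norm ?invr_ge0 ?exprn_ge0//.
  by ring.
have /choice[S aS] (w : R[i]) : exists l : R[i], series (fun m => a m * w ^+ m) @ \oo --> l.
  apply: normed_cvgC; rewrite (_ : (fun n => _) = (fun m => Normc.normc (a m) * Normc.normc w ^+ m)).
    exact/aN/normc_ge0.
  by apply/funext => m; rewrite Normc.normcM normcX.
exists S; split=> // [c _|x x0].
  have [u uS] := entire_recenter c aN aS; exists u.
  by apply/nearCP; exists 1 => // w _; exact: uS.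
apply: (cvgC_unique (aS _)); rewrite -[X in _ --> X]/(borel_real P phi x +i* 0).
apply: cvgC_ReIm.
  apply: (cvgn_ext (cvg_borel_real (phi := phi) eP x0)) => n.
  rewrite /series/= raddf_sum; apply: eq_bigr => m _.
  by rewrite /a -rmorphXn -rmorphM/= mulrAC.
apply: (cvgn_ext (@cvg_cst _ (0 : R) _ _ _)) => n.
rewrite /series/= raddf_sum big1// => m _.
by rewrite /a -rmorphXn -rmorphM.
Qed.

End complex_borel_transform.

(** [4 pi mu t = pi / beta]. *)
Lemma gauss_constant {R : realType} (p mu t beta : R) (n : nat) : 0 < p -> 0 < mu -> 0 < t ->
  beta = 1 / (4 * mu * t) ->
  (4 * p * mu * t) `^ (- (n%:R / 2)) =
  p `^ (- (n%:R / 2)) * beta `^ (n%:R / 2 - 1) * beta.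
Proof.
move=> p0 mu0 t0 betaE; have b0 : 0 < beta by rewrite betaE divr_gt0// !mulr_gt0.
have -> : 4 * p * mu * t = p * beta^-1.
  by rewrite betaE invf_div divr1; ring.
rewrite powRM ?invr_ge0 ?ltW// -mulrA; congr (_ * _).
rewrite -(powR_inv1 (ltW b0)) -powRrM mulN1r opprK.
rewrite -[X in _ = _ * X](powRr1 (ltW b0)) -powRD ?subrK//.
by apply/implyP => _; rewrite gt_eqF.
Qed.

Unset Implicit Arguments.
Local Open Scope complex_scope.

Theorem corollary3p2 (R : realType) (d : nat) (mu : R) (a : 'rV[R]_d) (z : R)
    (r : probability (borel_rV R d) R) (Phi : R -> 'rV[R]_d -> R)
    (t beta : R) (phi : 'rV[R]_d) :
  0 < mu -> 0 <= z ->
  r [set (0 : 'rV[R]_d)] = 0%E ->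
  levy_solution mu a z r Phi ->
  compact (msupport r) ->
  0 < t -> beta = 1 / (4 * mu * t) ->
  let s := borel_term a z r t phi in
  [/\ \forall tau \near 0, cvgn (series (s tau)),
      exists2 sigma, 0 < sigma &
        exists B, analytic_continuation s (strip sigma) B &
      forall sigma B, 0 < sigma -> analytic_continuation s (strip sigma) B ->
        let F (tau : R) := (expR (- (tau / beta)))%:C * B tau%:C in
        Cintegrable lebesgue_measure `[0, +oo[ F /\
        (Phi t phi)%:C =
          (pi `^ (- (d%:R / 2)) * beta `^ (d%:R / 2 - 1))%:C *
          Cintegral lebesgue_measure `[0, +oo[ F].
Proof.
move=> mu0 z0 _ solPhi cr t0 betaE s.
have b0 : 0 < beta by rewrite betaE divr_gt0// !mulr_gt0.
have [K K0 rK] := compact_msupport_ae cr.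
have er : exp_moments r := ae_bounded_exp_moments rK.
have tz0 : 0 <= t * z by rewrite mulr_ge0// ltW.
pose lam : {nonneg R} := NngNum tz0.
pose P := compound_poisson (- (t *: a)) lam r.
have eP : exp_moments P by exact: exp_moments_compound_poisson.
have mgfP eta : \int[P]_x expR (dot eta x) = expR (t * psi_jump a z r eta).
  rewrite compound_poisson_mgf// psi_jumpE//; congr expR.
  by rewrite dotNr dotC dotZl (_ : lam%:num = t * z)//; ring.
have [S [cS anS Sreal]] := complex_borel phi eP.
have sS tau : series (s tau) @ \oo --> S tau.
  apply: (cvgC_ext (cS tau)) => n; rewrite /series/=; apply: eq_bigr => m _.
  rewrite /s /borel_term -(moment_graphs phi er eP mgfP) exprNn.
  rewrite -/(sqmoment P phi m) /bessel_coef !rmorphM/= fmorphV/= !rmorphXn/=.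
  by rewrite rmorphN1 rmorph_nat; ring.
split.
- apply/nearCP.
  exists 1.
    by [].
  move=> tau _.
  exact: cvgC_cvgn (sS tau).
- exists 1 => //; exists S; split; last by apply/nearCP; exists 1 => // w _; exact: sS.
  by move=> c _; exact: anS.
move=> sigma B sigma0 [anB sB] F.
have BE x : 0 <= x -> B x%:C = (borel_real P phi x)%:C.
  move=> x0; rewrite -Sreal//; apply: (analytic_half_line _ anB anS _ x0).
    by move=> y y0; exact: strip_real.
  by apply: filterS sB => w wB; exact: (cvgC_unique wB (sS w)).
have FE x : `[0, +oo[%classic x -> F x = (expR (- beta^-1 * x) * borel_real P phi x)%:C.
  rewrite /= in_itv/= andbT => x0; rewrite /F BE// -rmorphM mulNr [x / _]mulrC.
  by [].
have [iF intF] := laplace_borel_real phi eP b0.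
split.
  split.
    apply: eq_integrable iF => // x; rewrite inE => /FE xF; rewrite /= xF.
    by [].
  apply: (eq_integrable _ (cst 0%E)) => //; last exact: integrable0.
  by move=> x; rewrite inE => /FE xF; rewrite /= xF.
have -> : Cintegral lebesgue_measure `[0, +oo[ F =
    (beta * \int[P]_x expR (- (beta * sqdist phi x)))%:C.
  rewrite /Cintegral; congr (Complex _ _).
    transitivity (\int[lebesgue_measure]_(x in `[0, +oo[)
        (expR (- beta^-1 * x) * borel_real P phi x)).
      by apply: eq_Rintegral => x; rewrite inE => /FE ->.
    rewrite intF RintegralZl//; apply: exp_type_integrable eP _.
    apply: (exp_type_bounded (C := 1)).
      apply: measurableT_comp => //; apply: measurableT_comp => //.
      by apply: measurable_funM => //; have [] := exp_type_sqdist phi.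
    move=> x; rewrite ger0_norm ?expR_ge0// -expR0 ler_expR oppr_le0.
    by rewrite mulr_ge0 ?sqdist_ge0// ltW.
  transitivity (\int[lebesgue_measure]_(x in `[0, +oo[) (0 : R)).
    by apply: eq_Rintegral => x; rewrite inE => /FE ->.
  by rewrite Rintegral_cst// mul0r.
rewrite -rmorphM; congr (_%:C).
have [nu [nuE ->]] := solPhi t t0.
have lamE : lam%:num = t * z by [].
have [ig igE] := gaussian_mean (fourier_levy er lamE nuE) phi (ltW b0).
transitivity ((4 * pi * mu * t) `^ (- (d%:R / 2)) *
    \int[nu]_x expR (- (beta * dot (phi - (x : 'rV[R]_d)) (phi - (x : 'rV[R]_d))))).
  rewrite -RintegralZl//; apply: eq_Rintegral => x _.
  by rewrite /gauss betaE mul1r [_^-1 * _]mulrC.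
by rewrite igE (gauss_constant d (pi_gt0 R) mu0 t0 betaE) -mulrA.
Qed.
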